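(* Let $\mathcal{T}$ be a positive linear form on $\mathcal{L}_{n,m}$ for which there is a polynomial $p\in\mathbb{C}[z,w]$ with no zeros on $\mathbb{T}\times\overline{\mathbb{D}}$ and degree at most $(n,m)$ such that $$\mathcal{T}(z^jw^k)=\int_{\mathbb{T}^2} z^jw^k\,\frac{|dz||dw|}{(2\pi)^2|p(z,w)|^2}\qquad\text{for all } |j|\le n,\ |k|\le m.$$ Write $p(z,0)=a(z)b(z)$ where $a\in\mathbb{C}[z]$ has no zeros in $\overline{\mathbb{D}}$ and $b\in\mathbb{C}[z]$ has all its zeros in $\mathbb{D}$. Then the subspaces $$\mathcal{K}_1=P_{\mathcal{E}^1_{n-1,m}}\{g(z)a(z): g\in\mathbb{C}[z],\ \deg g<\deg b\},\qquad \mathcal{K}_2=P_{\mathcal{E}^1_{n-1,m}}\{g(z)b(z): g\in\mathbb{C}[z],\ \deg g<n-\deg b\}$$ satisfy the split-shift condition, i.e. (1) $\mathcal{E}^1_{n-1,m}=\mathcal{K}_1\oplus\mathcal{K}_2$, (2) $\mathcal{K}_1\perp z\mathcal{K}_2$, and (3) $\mathcal{K}_1,\ z\mathcal{K}_2\subset\mathcal{E}^1_{n,m}$.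
   Context: $\mathbb{D}=\{|z|<1\}$, $\mathbb{T}=\partial\mathbb{D}$; $n,m$ are nonnegative integers. $\mathcal{L}_{j,k}$ is the complex span of $z^sw^t$, $-j\le s\le j$, $-k\le t\le k$, and $\mathcal{P}_{j,k}$ the complex span of $z^sw^t$, $0\le s\le j$, $0\le t\le k$ (with $\mathcal{P}_{j,k}=\{0\}$ if $j<0$ or $k<0$). Degree at most $(n,m)$ means membership in $\mathcal{P}_{n,m}$. For a polynomial $g$, $\bar g(z,w)=\overline{g(\bar z,\bar w)}$. A linear form $\mathcal{T}:\mathcal{L}_{n,m}\to\mathbb{C}$ is positive if $\mathcal{T}(f(z,w)\bar f(1/z,1/w))>0$ for all nonzero $f\in\mathcal{P}_{n,m}$. $\mathcal{H}_{\mathcal T}$ is $\mathcal{P}_{n,m}$ with inner product $\langle f,g\rangle_{\mathcal T}=\mathcal{T}(f(z,w)\bar g(1/z,1/w))$; all orthogonality, orthogonal direct sums, complements and orthogonal projections $P_{\mathcal M}$ are in $\mathcal{H}_{\mathcal T}$. $\mathcal{E}^1_{k,l}=\mathcal{P}_{k,l}\ominus w\mathcal{P}_{k,l-1}$. The zero polynomial is considered to satisfy every degree bound $\deg g<d$. *)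

(* Defs.v *)
From HB Require Import structures.
From mathcomp Require Import all_boot all_order all_algebra fraction.
From mathcomp Require Import all_classical all_reals all_analysis.
From mathcomp Require Import complex.

Set Implicit Arguments.
Unset Strict Implicit.
Unset Printing Implicit Defensive.
Import Order.TTheory GRing.Theory Num.Theory.

Local Open Scope classical_set_scope.
Local Open Scope ring_scope.
Local Open Scope complex_scope.

(* C[z,w] is rendered as C[z][w]: w is the outer variable 'X, z is the inner
   one 'X%:P, so that p(z,0) is p`_0. *)
Notation bipoly R := {poly {poly R[i]}}.

Definition ev (R : realType) (f : bipoly R) (z w : R[i]) : R[i] :=
  f.[w%:P].[z].

Definition barp (R : realType) (f : bipoly R) : bipoly R :=
  map_poly (map_poly (@conjc R)) f.

Lemma ev_barp (R : realType) (f : bipoly R) (z w : R[i]) :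
  ev (barp f) z w = (ev f z^* w^* )^*.
Proof.
rewrite /ev /barp -(conjcK w) -map_polyC horner_map -{1}(conjcK z) horner_map.
by rewrite !conjcK.
Qed.

(* C(z,w), in which Laurent polynomials live. *)
Notation ratfun R := {fraction {poly {poly R[i]}}}.

Definition zvar (R : realType) : ratfun R := tofrac 'X%:P.
Definition wvar (R : realType) : ratfun R := tofrac 'X.
Definition ratconst (R : realType) (c : R[i]) : ratfun R := tofrac c%:P%:P.

(* f(x, y) for x, y in C(z,w) *)
Definition subst (R : realType) (f : bipoly R) (x y : ratfun R) : ratfun R :=
  (map_poly (fun q : {poly R[i]} => (map_poly (@ratconst R) q).[x]) f).[y].

(* the space L_{j,k}: the exponents s - j and t - k run over [-j, j] and
   [-k, k] *)
Definition laurent (R : realType) (j k : nat) : set (ratfun R) :=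
  [set F | exists c : 'M[R[i]]_((2 * j).+1, (2 * k).+1),
    F = \sum_s \sum_t ratconst (c s t)
          * (zvar R ^ (s%:Z - j%:Z) * wvar R ^ (t%:Z - k%:Z))].

(* the space P_{j,k}, equal to {0} as soon as j < 0 or k < 0 *)
Definition Pspace (R : realType) (j k : int) : set (bipoly R) :=
  [set f : bipoly R |
    forall s t : nat, (f`_t)`_s != 0 -> s%:Z <= j /\ t%:Z <= k].

(* T is a total function on C(z,w); only its restriction to L_{n,m} matters. *)
Definition linear_form (R : realType) (n m : nat) (T : ratfun R -> R[i]) :=
  forall (c : R[i]) (F G : ratfun R), laurent n m F -> laurent n m G ->
    T (ratconst c * F + G) = c * T F + T G.

Definition ip (R : realType) (T : ratfun R -> R[i]) (f g : bipoly R) : R[i] :=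
  T (subst f (zvar R) (wvar R) * subst (barp g) (zvar R)^-1 (wvar R)^-1).

(* In R[i], 0 < x means that x is real and positive. *)
Definition positive_form (R : realType) (n m : nat) (T : ratfun R -> R[i]) :=
  forall f : bipoly R, Pspace n%:Z m%:Z f -> f != 0 -> 0 < ip T f f.

Definition circ (R : realType) (t : R) : R[i] := cos t +i* sin t.

(* integral of F(z,w) |dz||dw| over T^2 *)
Definition torus_int (R : realType) (F : R[i] -> R[i] -> R[i]) : R[i] :=
  let D : set (R * R) := `[0, 2 * pi] `*` `[0, 2 * pi] in
  let mu := (@lebesgue_measure R \x @lebesgue_measure R)%E in
  (\int[mu]_(x in D) complex.Re (F (circ x.1) (circ x.2)))
  +i* (\int[mu]_(x in D) complex.Im (F (circ x.1) (circ x.2))).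

Definition orth (R : realType) (T : ratfun R -> R[i]) (A B : set (bipoly R)) :=
  forall f g, A f -> B g -> ip T f g = 0.

Definition ominus (R : realType) (T : ratfun R -> R[i])
    (A B : set (bipoly R)) : set (bipoly R) :=
  [set f | A f /\ forall g, B g -> ip T f g = 0].

Definition zmul (R : realType) (A : set (bipoly R)) : set (bipoly R) :=
  [set 'X%:P * f | f in A].
Definition wmul (R : realType) (A : set (bipoly R)) : set (bipoly R) :=
  [set 'X * f | f in A].

Definition E1 (R : realType) (T : ratfun R -> R[i]) (k l : int) :
    set (bipoly R) :=
  ominus T (@Pspace R k l) (wmul (@Pspace R k (l - 1))).

Definition is_proj (R : realType) (T : ratfun R -> R[i])
    (M : set (bipoly R)) (f h : bipoly R) :=
  M h /\ forall g, M g -> ip T (f - h) g = 0.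

Definition proj_image (R : realType) (T : ratfun R -> R[i])
    (M S : set (bipoly R)) : set (bipoly R) :=
  [set h | exists2 f, S f & is_proj T M f h].

Definition degp (R : realType) (g : {poly R[i]}) : nat := (size g).-1.

(* The zero polynomial satisfies every bound deg g < d. *)
Definition deg_lt (R : realType) (g : {poly R[i]}) (d : int) :=
  g = 0 \/ (degp g)%:Z < d.

Definition multiples (R : realType) (q : {poly R[i]}) (d : int) :
    set (bipoly R) :=
  [set (g * q)%:P | g in [set g | deg_lt g d]].

Definition is_subspace (R : realType) (K : set (bipoly R)) :=
  K 0 /\ forall (c : R[i]) (f g : bipoly R), K f -> K g ->
    K (c%:P%:P * f + g).

Definition orth_sum (R : realType) (T : ratfun R -> R[i])
    (E A B : set (bipoly R)) :=
  E = [set f + g | f in A & g in B] /\ orth T A B.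

Definition split_shift (R : realType) (T : ratfun R -> R[i]) (n m : nat)
    (K1 K2 : set (bipoly R)) :=
  [/\ is_subspace K1 /\ is_subspace K2,
      orth_sum T (E1 T (n%:Z - 1) m%:Z) K1 K2,
      orth T K1 (zmul K2) &
      K1 `<=` E1 T n%:Z m%:Z /\ zmul K2 `<=` E1 T n%:Z m%:Z].

(* Main.v *)
Require Import Defs.
From HB Require Import structures.
From mathcomp Require Import all_boot all_order all_algebra fraction.
From mathcomp Require Import all_classical all_reals all_analysis.
From mathcomp Require Import measurable_realfun.
From mathcomp Require Import complex.
From mathcomp Require Import ring lra zify.

Set Implicit Arguments.
Unset Strict Implicit.
Unset Printing Implicit Defensive.
Import Order.TTheory GRing.Theory Num.Theory.
Import numFieldNormedType.Exports.

Local Open Scope classical_set_scope.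
Local Open Scope ring_scope.
Local Open Scope complex_scope.

(** Write [<f, g>] for the integral of [f conj(g) / |p|^2] over the torus, with
    normalized arc length in each variable.  By [ip_ipw] it is the inner product of
    [T] on polynomials of degree at most [(n, m)], but it also makes sense for
    arbitrary Laurent polynomials, and the proof takes place there.

    For fixed [z] on the circle, [1 / p(z, .)] is analytic in the disk, so that
    [z^i w^k / p] has mean zero for [k >= 1] ([mono_over_p]).  Hence the mean of
    [z^i F / p] depends only on [F(z, 0)] ([mean_over_p_const]).

    Let [F] be in [E], the space of the statement, of degree at most [(n - 1, m)].
    The moments [y_(i, j) = <F, z^i w^(j + 1)>], for [j < m] and all integers [i],
    are zero for [0 <= i < n].  The Christoffel-Darboux kernel of the weight
    [1 / |p(z, .)|^2] on polynomials of degree less than [m] in [w] is a Laurent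
    polynomial of degree [n] in [z].  Its kernel property ([cd_pairing]) turns into
    a banded block Toeplitz system for [y]: the right-hand side at [i] is a
    coefficient of [F] minus a Fourier coefficient of
    [F(z, 0) p_(k + 1)(z) / p(z, 0)], where [p_(k + 1)] is the coefficient of
    [w^(k + 1)] in [p].  This splits into two cases.

    If [F(z, 0) = g a], then [F(z, 0) / p(z, 0) = g / b] has only negative Fourier
    coefficients, since [deg g < deg b] and [b] has its zeros in the disk.  The
    right-hand side vanishes for [i >= n].  If [F(z, 0) = h b], the quotient [h / a]
    has only nonnegative coefficients, and the right-hand side vanishes for [i < 0].
    In either case the corresponding half of [y] solves a homogeneous one-sided
    system.  The system is coercive because the weight is bounded
    ([cd_coercive]), and a bounded solution of such a system is zero
    ([toeplitz_bounded_kernel]).  So the moments vanish for all [i >= 0] in the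
    first case ([split_right]) and for all [i < n] in the second ([split_left]).
    This gives the inclusions of [K1] and [z K2] in the larger space.

    For the orthogonality, take [F] in [K1] and [G] in [K2] with
    [G(z, 0) = h b].  Then [a G = h p + w Q] for a polynomial [Q], and [F] is
    orthogonal to [z^k h p] and to [z^k w Q] for all [k >= 0]; since [a] has no
    zeros in the closed disk, it is orthogonal to all [z^k G] ([split_orth]), and
    [k = 0, 1] are what is needed.  Finally the projection onto [E] does not
    change the coefficient of [w^0] ([proj_multiplesP]), so that [E = K1 + K2]
    reduces to writing a polynomial of degree less than [n] as [g a + h b], which
    is possible as [a] and [b] are coprime.

    All analyticity statements are obtained from [bounded_recurrence_eq0]: the
    Fourier coefficients of [1 / q] are bounded and satisfy the linear recurrence
    with characteristic polynomial [q]. *)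

(** * Bounded solutions of linear recurrences *)

(** Conjugation by a name that means the same in every notation scope. *)
Local Notation cj := (@conjc _).
Local Notation nc := Normc.normc.

Section Sequences.
Variable R : realType.
Implicit Types (q : {poly R[i]}) (x : nat -> R[i]).

Lemma archimedean_le0 (a b : R) : (forall j, j%:R * a <= b) -> a <= 0.
Proof.
move=> h; rewrite leNgt; apply/negP => a0.
have b0 : 0 <= b by have := h 0; rewrite mul0r.
have := archi_boundP (divr_ge0 b0 (ltW a0)).
by rewrite ltr_pdivrMr// ltNge h.
Qed.

Definition recur q x k := \sum_(l < size q) q`_l * x (k + l)%N.

Lemma recur_widen N q x k : (size q <= N)%N ->
  recur q x k = \sum_(l < N) q`_l * x (k + l)%N.
Proof.
move=> hN; rewrite /recur (big_ord_widen N (fun l => q`_l * x (k + l)%N))//.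
rewrite big_mkcond/=; apply: eq_bigr => l _; case: ltnP => // h.
by rewrite nth_default// mul0r.
Qed.

Lemma recur_XsubC q (r : R[i]) x k :
  recur (q * ('X - r%:P)) x k = recur q (fun k => x k.+1 - r * x k) k.
Proof.
have hs : (size (q * ('X - r%:P))%R <= (size q).+1)%N.
  by rewrite (leq_trans (size_polyMleq _ _))// size_XsubC addn2.
rewrite (recur_widen _ _ hs) (@recur_widen (size q).+1 q)//.
under eq_bigr do rewrite mulrBr coefB coefMX coefMC mulrBl.
under [RHS]eq_bigr do rewrite mulrBr.
rewrite !sumrB; congr (_ - _); last by apply: eq_bigr => l _; ring.
rewrite big_ord_recl/= mul0r add0r big_ord_recr/= nth_default// mul0r addr0.
by apply: eq_bigr => l _ /=; rewrite addnS.
Qed.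

(** A factor [shift - r] with [`|r| > 1] only kills the geometric sequences of
    ratio [r], which are unbounded; so the linear factors of [q] can be removed one
    at a time. *)
Lemma bounded_recurrence_eq0 q x (B : R) :
    (forall z : R[i], `|z| <= 1 -> q.[z] != 0) ->
    (forall k, nc (x k) <= B) -> (forall k, recur q x k = 0) ->
  forall k, x k = 0.
Proof.
move=> hq hB hx; have [rs def_q] := closed_field_poly_normal q.
have lq0 : lead_coef q != 0.
  by rewrite lead_coef_eq0; apply: contraTneq (hq 0 _) => [->|];
    rewrite ?horner0 ?normr0 ?ler01 ?eqxx.
have hrs : forall r, r \in rs -> 1 < nc r.
  move=> r rrs; rewrite ltNge; apply/negP => hr.
  have : root q r by rewrite def_q rootZ// root_prod_XsubC.
  apply/negP/hq; by rewrite -(rmorph1 (real_complex R)) lecR.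
have {}hx k : recur (\prod_(z <- rs) ('X - z%:P)) x k = 0.
  apply/(mulfI lq0); rewrite mulr0 -[RHS](hx k).
  rewrite [in RHS]def_q /recur size_scale// mulr_sumr.
  by apply: eq_bigr => l _; rewrite coefZ mulrA.
elim: rs {q hq def_q lq0} x B hB hrs hx => [|r rs IH] x B hB hrs hx k.
  by have := hx k; rewrite big_nil /recur size_poly1 big_ord1 coef1 mul1r addn0.
have r1 : 1 < nc r by apply: hrs; rewrite mem_head.
have step j : x j.+1 = r * x j.
  apply/eqP; rewrite -subr_eq0; apply/eqP.
  apply: (IH (fun k => x k.+1 - r * x k) (B + nc r * B)) => [i|s srs|i].
  - rewrite (le_trans (le_normcD _ _))// normcN Normc.normcM lerD//.
    by rewrite ler_wpM2l// (le_trans _ (ltW r1)).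
  - by apply: hrs; rewrite in_cons srs orbT.
  - by rewrite -recur_XsubC mulrC -(hx i) big_cons.
have geom j : nc (x (k + j)%N) = nc r ^+ j * nc (x k).
  elim: j => [|j IHj]; first by rewrite addn0 mul1r.
  by rewrite addnS step Normc.normcM IHj exprS mulrA.
have bern j : 1 + j%:R * (nc r - 1) <= nc r ^+ j.
  elim: j => [|j IHj]; first by rewrite mul0r addr0.
  have h1 : nc r * (1 + j%:R * (nc r - 1)) <= nc r * nc r ^+ j.
    by rewrite ler_wpM2l// (le_trans _ (ltW r1)).
  have h2 : 0 <= j%:R * (nc r - 1) ^+ 2 by rewrite mulr_ge0// sqr_ge0.
  rewrite exprS -natr1; nra.
have n0 : 0 <= nc (x k) by rewrite -lecR; exact: (normr_ge0 (x k)).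
have : nc (x k) * (nc r - 1) <= 0.
  apply: (@archimedean_le0 _ B) => j.
  have := hB (k + j)%N; rewrite geom; apply: le_trans.
  rewrite mulrCA mulrC ler_wpM2r// (le_trans _ (bern j))// lerDr//.
move=> h; apply/Normc.eq0_normc/eqP; rewrite eq_le n0 andbT.
by move: h; rewrite pmulr_lle0// subr_gt0.
Qed.

End Sequences.

(** * Bounded solutions of banded Toeplitz systems *)

Section Toeplitz.
Variable R : realType.

Lemma nc_ge0 (z : R[i]) : 0 <= nc z.
Proof. by rewrite -lecR; exact: (normr_ge0 z). Qed.

Lemma Re_le_nc (z : R[i]) : `|complex.Re z| <= nc z.
Proof. by rewrite -lecR; exact: normc_ge_Re. Qed.

Lemma nc_conj (z : R[i]) : nc z^* = nc z.
Proof. by case: z => a b /=; rewrite sqrrN. Qed.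

Lemma nc_sum (I : Type) (r : seq I) (P : pred I) (F : I -> R[i]) :
  nc (\sum_(i <- r | P i) F i) <= \sum_(i <- r | P i) nc (F i).
Proof.
elim/big_rec2: _ => [|i y1 y2 _ h]; first by rewrite Normc.normc0.
by rewrite (le_trans (le_normcD _ _))// lerD2l.
Qed.

(** Along the progression [N + j * h] the right-hand sides telescope, so that
    [j%:R * (c * s N)], which is at most the sum of [j] of the left-hand sides,
    stays bounded. *)
Lemma slow_growth_eq0 (s : nat -> R) (c K L : R) (h : nat) :
    0 < c -> 0 <= K -> (forall N, 0 <= s N) -> {homo s : i j / (i <= j)%N >-> i <= j} ->
    (forall N, c * s N <= K * (s (N + h)%N - s (N - h)%N)) ->
    (forall N, s (N + h)%N - s (N - h)%N <= L) ->
  forall N, s N = 0.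
Proof.
move=> c0 K0 s0 smono hs hL N.
have bnd M : s M <= K * L / c.
  by rewrite ler_pdivlMr// mulrC (le_trans (hs M))// ler_wpM2l.
pose t j := s (N + j * h)%N.
have tele j : j%:R * (c * s N) <= K * (t j + t j.+1).
  elim: j => [|j IH]; first by rewrite mul0r mulr_ge0// addr_ge0/t.
  have h1 : c * s N <= c * t j.+1 by rewrite ler_wpM2l ?(ltW c0)// smono// leq_addr.
  have h2 := hs (N + j.+1 * h)%N.
  have e1 : s (N + j.+1 * h + h)%N = t j.+2.
    by rewrite /t; congr s; rewrite !mulSn; lia.
  have e2 : s (N + j.+1 * h - h)%N = t j.
    by rewrite /t; congr s; rewrite !mulSn; lia.
  rewrite e1 e2 in h2; rewrite -natr1; rewrite /t in h1 h2 IH *; nra.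
have h1 : c * s N <= 0.
  apply: (@archimedean_le0 R _ (K * (K * L / c + K * L / c))) => j.
  by rewrite (le_trans (tele j))// ler_wpM2l// lerD// bnd.
by apply/eqP; rewrite eq_le s0 andbT; nra.
Qed.

Variables (n m : nat) (g : int -> 'I_m -> 'I_m -> R[i]).
Hypothesis g_band : forall d k j, (n < `|d|)%N -> g d k j = 0.
Variable (c : R).
Hypothesis c_gt0 : 0 < c.

Definition toeplitz_form N (v : nat -> 'I_m -> R[i]) : R[i] :=
  \sum_(i < N) \sum_(i' < N) \sum_k \sum_j
    v i k * cj (v i' j) * g (i'%:Z - i%:Z) k j.

Hypothesis g_coercive : forall N (v : nat -> 'I_m -> R[i]),
  c * \sum_(i < N) \sum_k nc (v i k) ^+ 2 <= complex.Re (toeplitz_form N v).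

Lemma g_bounded : exists2 G, 0 <= G & forall d k j, nc (g d k j) <= G.
Proof.
pose F (d : 'I_(n + n).+1) := \sum_k \sum_j nc (g (d%:Z - n%:Z) k j).
exists (\sum_d F d) => [|d k j].
  by do 3! apply: sumr_ge0 => ? _; exact: nc_ge0.
have [dn|dn] := ltnP n `|d|.
  rewrite g_band// Normc.normc0.
  by do 3! apply: sumr_ge0 => ? _; exact: nc_ge0.
have hd : (`|(d + n%:Z)%R| < (n + n).+1)%N by lia.
have ed : d = (Ordinal hd)%:Z - n%:Z by rewrite /=; lia.
rewrite (bigD1 (Ordinal hd))//= /F (bigD1 k)//= (bigD1 j)//= -ed.
rewrite -!addrA lerDl !addr_ge0//; repeat (apply: sumr_ge0 => ? _);
  exact: nc_ge0.
Qed.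

(** Pairing the system with the truncation of [x] to indices less than [N] leaves
    only terms with indices near [N]: the sum of squares before [N] is at most a
    constant times the part of the sum that lies within [n.+1] of [N].  By
    [slow_growth_eq0] this is impossible for a bounded [x] unless [x = 0]. *)
Lemma toeplitz_bounded_kernel (x : nat -> 'I_m -> R[i]) (B : R) :
    (forall i k, nc (x i k) <= B) ->
    (forall i k, \sum_(i' < (i + n).+1) \sum_j
       cj (g (i'%:Z - i%:Z) k j) * x i' j = 0) ->
  forall i k, x i k = 0.
Proof.
move=> hB hx.
have [G G0 hG] := g_bounded.
pose w i := \sum_k nc (x i k) ^+ 2.
have w0 i : 0 <= w i by apply: sumr_ge0 => k _; rewrite exprn_ge0 ?nc_ge0.
pose s N := \sum_(i < N) w i.
have sS N : s N.+1 = s N + w N by rewrite /s big_ord_recr.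
have smono : {homo s : i j / (i <= j)%N >-> i <= j}.
  apply: homo_leq => [//|? ? ?|i]; [exact: le_trans|by rewrite sS lerDl].
have s0 N : 0 <= s N by apply: sumr_ge0 => i _.
pose h := n.+1.
have wW N i : (N - h <= i)%N -> (i < N + h)%N -> w i <= s (N + h)%N - s (N - h)%N.
  move=> h1 h2; have := smono _ _ h2; have := smono _ _ h1; rewrite sS; lra.
pose W N := s (N + h)%N - s (N - h)%N.
have W0 N : 0 <= W N by rewrite subr_ge0 smono//; lia.
have xW N i k : (N - h <= i)%N -> (i < N + h)%N -> nc (x i k) ^+ 2 <= W N.
  move=> h1 h2; rewrite (le_trans _ (wW _ _ h1 h2))// /w (bigD1 k)//= lerDl.
  by apply: sumr_ge0 => ? _; rewrite exprn_ge0 ?nc_ge0.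
have xxW N i k i' j : (N - h <= i)%N -> (i < N)%N -> (N <= i')%N -> (i' < N + h)%N ->
    nc (x i k) * nc (x i' j) <= W N.
  move=> h1 h2 h3 h4.
  have := xW N i k h1 (leq_trans h2 (leq_addr _ _)).
  have := xW N i' j (leq_trans (leq_subr _ _) h3) h4.
  have := sqr_ge0 (nc (x i k) - nc (x i' j)); nra.
(* There are at most [h * (m * (h * m))] boundary terms, each at most [G * W N]. *)
pose K := (h * (m * (h * m)))%:R * G.
have K0 : 0 <= K by rewrite mulr_ge0.
have tail N i k : (i < N)%N ->
    \sum_(i' < N) \sum_j cj (g (i'%:Z - i%:Z) k j) * x i' j
    = - \sum_(l < h) \sum_j cj (g ((N + l)%N%:Z - i%:Z) k j) * x (N + l)%N j.
  move=> iN; apply/eqP; rewrite -addr_eq0; apply/eqP.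
  transitivity (\sum_(i' < N + h) \sum_j cj (g (i'%:Z - i%:Z) k j) * x i' j).
    by rewrite big_split_ord.
  have hle : ((i + n).+1 <= N + h)%N by rewrite /h; lia.
  rewrite -[RHS](hx i k).
  rewrite [RHS](big_ord_widen _ (fun i' : nat => \sum_j cj (g (i'%:Z - i%:Z) k j) * x i' j) hle).
  rewrite [RHS]big_mkcond/=; apply: eq_bigr => i' _; case: ltnP => // hi'.
  apply: big1 => j _; rewrite g_band ?rmorph0 ?mul0r//; lia.
have key N : c * s N <= K * W N.
  apply: le_trans (g_coercive N x) _.
  apply: le_trans (ler_norm _) _; apply: le_trans (Re_le_nc _) _.
  have -> : toeplitz_form N x = - \sum_(i < N) \sum_k \sum_(l < h) \sum_j
      x i k * cj (x (N + l)%N j) * g ((N + l)%N%:Z - i%:Z) k j.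
    rewrite /toeplitz_form -sumrN; apply: eq_bigr => i _.
    rewrite exchange_big/= -sumrN; apply: eq_bigr => k _.
    transitivity (x i k * cj (\sum_(i' < N) \sum_j cj (g (i'%:Z - i%:Z) k j) * x i' j)).
      rewrite rmorph_sum mulr_sumr; apply: eq_bigr => i' _.
      rewrite rmorph_sum mulr_sumr; apply: eq_bigr => j _.
      by rewrite rmorphM/= conjcK; ring.
    rewrite tail// rmorphN mulrN rmorph_sum mulr_sumr; congr (- _).
    apply: eq_bigr => l _.
    rewrite rmorph_sum mulr_sumr; apply: eq_bigr => j _.
    by rewrite rmorphM/= conjcK; ring.
  rewrite normcN.
  have term (i : 'I_N) k (l : 'I_h) j :
      nc (x i k * cj (x (N + l)%N j) * g ((N + l)%N%:Z - i%:Z) k j)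
      <= (if (N - h <= i)%N then G * W N else 0).
    case: leqP => [hi|hi].
      rewrite !Normc.normcM nc_conj mulrC ler_pM ?mulr_ge0 ?nc_ge0//.
      by apply: xxW => //; rewrite ?leq_addr// ltn_add2l.
    by rewrite g_band ?mulr0 ?Normc.normc0//; move: (ltn_ord i); rewrite /h in hi *; lia.
  pose e := G * W N.
  have e0 : 0 <= e by rewrite mulr_ge0.
  apply: (@le_trans _ _ (\sum_(i < N) (if (N - h <= i)%N then (m * (h * m))%:R * e else 0))).
    apply: le_trans (nc_sum _ _ _) _; apply: ler_sum => i _.
    apply: le_trans (nc_sum _ _ _) _.
    apply: (@le_trans _ _ (\sum_(k < m) \sum_(l < h) \sum_(j < m)
        (if (N - h <= i)%N then e else 0))).
      apply: ler_sum => k _; apply: le_trans (nc_sum _ _ _) _.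
      apply: ler_sum => l _; apply: le_trans (nc_sum _ _ _) _.
      by apply: ler_sum => j _; exact: term.
    rewrite !sumr_const !card_ord -!mulrnA; case: ifP => _; last by rewrite mul0rn.
    by rewrite mulr_natl (_ : (m * (h * m) = m * h * m)%N)//; lia.
  rewrite -big_mkcond/= sumr_const /K; set M := (m * (h * m))%N.
  rewrite -mulrA -/e natrM -mulrA.
  rewrite -[leLHS]mulr_natl ler_wpM2r ?mulr_ge0// ler_nat.
  rewrite -sum1_card (_ : \sum_(i in _) 1 = \sum_(N - h <= i < N) 1)%N; last first.
    by rewrite big_geq_mkord; apply: eq_bigl.
  by rewrite sum_nat_const_nat muln1; lia.
have L N : W N <= (h + h)%:R * (m%:R * B ^+ 2).
  have wB j : w j <= m%:R * B ^+ 2.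
    rewrite /w mulr_natl -[m in _ *+ m]card_ord -sumr_const; apply: ler_sum => k _.
    by rewrite lerXn2r ?nnegrE ?nc_ge0// (le_trans (nc_ge0 (x j k))).
  have sB b d : s (b + d)%N <= s b + d%:R * (m%:R * B ^+ 2).
    elim: d => [|d IH]; first by rewrite addn0 mul0r addr0.
    by rewrite addnS sS -natr1 mulrDl mul1r addrA lerD.
  rewrite /W; have -> : (N + h = N - h + (N + h - (N - h)))%N by lia.
  rewrite lerBlDl (le_trans (sB _ _))// lerD2l ler_wpM2r ?(le_trans (w0 0%N))//.
  by rewrite ler_nat; lia.
have sz := @slow_growth_eq0 s c K _ h c_gt0 K0 s0 smono key L.
move=> i k; apply: Normc.eq0_normc; apply/eqP; rewrite -sqrf_eq0; apply/eqP.
have := sz i.+1; rewrite sS sz add0r => /eqP.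
rewrite /w psumr_eq0 => [/allP/(_ k)|? _]; last by rewrite exprn_ge0 ?nc_ge0.
by rewrite mem_index_enum => /(_ isT)/eqP.
Qed.
End Toeplitz.

(** * Integrals of bounded complex functions *)

Section ComplexIntegral.
Context d (S : measurableType d) (R : realType).
Variables (mu : {measure set S -> \bar R}) (D : set S).
Hypotheses (mD : measurable D) (finD : (mu D < +oo)%E).
Implicit Types (f g : S -> R[i]) (c : R[i]).

Definition cint f : R[i] :=
  (\int[mu]_(x in D) complex.Re (f x)) +i* (\int[mu]_(x in D) complex.Im (f x)).

(** Boundedness makes this class stable under products, and it implies
    integrability since [D] has finite measure. *)
Definition bmeas f := [/\ measurable_fun D (fun x => complex.Re (f x)),
  measurable_fun D (fun x => complex.Im (f x)) &
  exists M : R, forall x, D x -> nc (f x) <= M].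

Lemma Im_le_nc (z : R[i]) : `|complex.Im z| <= nc z.
Proof.
have -> : complex.Im z = complex.Re (z * - 'i%C) by case: z => a b; simpc.
apply: le_trans (Re_le_nc _) _.
by rewrite Normc.normcM normcN /= expr0n/= add0r expr1n sqrtr1 mulr1.
Qed.

Lemma cReD (z w : R[i]) : complex.Re (z + w) = complex.Re z + complex.Re w.
Proof. by case: z w => [? ?] [? ?]. Qed.
Lemma cImD (z w : R[i]) : complex.Im (z + w) = complex.Im z + complex.Im w.
Proof. by case: z w => [? ?] [? ?]. Qed.
Lemma cReM (z w : R[i]) : complex.Re (z * w)
  = complex.Re z * complex.Re w - complex.Im z * complex.Im w.
Proof. by case: z w => [? ?] [? ?]. Qed.
Lemma cImM (z w : R[i]) : complex.Im (z * w)
  = complex.Re z * complex.Im w + complex.Im z * complex.Re w.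
Proof. by case: z w => [? ?] [? ?]. Qed.

Lemma bmeas_ext f g : f =1 g -> bmeas f -> bmeas g.
Proof. by move=> /funext ->. Qed.

Lemma bmeas_cst c : bmeas (fun=> c).
Proof. by split; [exact: measurable_cst..|exists (nc c)]. Qed.

Lemma bmeasD f g : bmeas f -> bmeas g -> bmeas (fun x => f x + g x).
Proof.
move=> [f1 f2 [M fM]] [g1 g2 [N gN]]; split.
- by under eq_fun do rewrite cReD; exact: measurable_funD.
- by under eq_fun do rewrite cImD; exact: measurable_funD.
- exists (M + N) => x Dx; rewrite (le_trans (le_normcD _ _))// lerD ?fM ?gN//.
Qed.

Lemma bmeasM f g : bmeas f -> bmeas g -> bmeas (fun x => f x * g x).
Proof.
move=> [f1 f2 [M fM]] [g1 g2 [N gN]]; split.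
- under eq_fun do rewrite cReM.
  by apply: measurable_funB; exact: measurable_funM.
- under eq_fun do rewrite cImM.
  by apply: measurable_funD; exact: measurable_funM.
- by exists (M * N) => x Dx; rewrite Normc.normcM ler_pM ?nc_ge0 ?fM ?gN.
Qed.

Lemma bmeas_conj f : bmeas f -> bmeas (fun x => cj (f x)).
Proof.
have e (z : R[i]) : complex.Re (cj z) = complex.Re z /\ complex.Im (cj z) = - complex.Im z.
  by case: z.
move=> [f1 f2 [M fM]]; split.
- by under eq_fun do rewrite (e _).1.
- by under eq_fun do rewrite (e _).2; exact: measurable_funN.
- by exists M => x Dx; rewrite nc_conj fM.
Qed.

Lemma bmeasX f k : bmeas f -> bmeas (fun x => f x ^+ k).
Proof.
move=> hf; elim: k => [|k IH]; first exact: bmeas_cst.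
by under eq_fun do rewrite exprS; exact: bmeasM.
Qed.

Lemma bmeas_sum (I : Type) (r : seq I) (P : pred I) (F : I -> S -> R[i]) :
  (forall i, P i -> bmeas (F i)) -> bmeas (fun x => \sum_(i <- r | P i) F i x).
Proof.
move=> hF; elim: r => [|i r IH].
  by under eq_fun do rewrite big_nil; exact: bmeas_cst.
case Pi: (P i); under eq_fun do rewrite big_cons Pi; last exact: IH.
by apply: bmeasD => //; exact: hF.
Qed.

(** The inverse of the squared modulus is measurable as a real power. *)
Lemma bmeas_inv f (e : R) : 0 < e -> (forall x, D x -> e <= nc (f x)) ->
  bmeas f -> bmeas (fun x => (f x)^-1).
Proof.
move=> e0 ef [f1 f2 [M fM]].
pose h x := complex.Re (f x) ^+ 2 + complex.Im (f x) ^+ 2.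
have mh : measurable_fun D (fun x => (h x)^-1).
  have -> : (fun x => (h x)^-1) = (@powR R ^~ (-1)) \o h.
    by apply/funext => x /=; rewrite powR_inv1// addr_ge0// sqr_ge0.
  apply: measurableT_comp; first exact: measurable_powR.
  by apply: measurable_funD; exact: measurable_funX.
have eRe x : complex.Re (f x)^-1 = complex.Re (f x) * (h x)^-1.
  by rewrite /h; case: (f x).
have eIm x : complex.Im (f x)^-1 = - (complex.Im (f x) * (h x)^-1).
  by rewrite /h; case: (f x).
split.
- by under eq_fun do rewrite eRe; exact: measurable_funM.
- under eq_fun do rewrite eIm.
  by apply: measurable_funN; exact: measurable_funM.
- exists e^-1 => x Dx; rewrite Normc.normcV lef_pV2 ?posrE ?ef//.
  exact: lt_le_trans (ef _ Dx).
Qed.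

Lemma Rintegral0 : \int[mu]_(x in D) (0 : R) = 0.
Proof. by rewrite Rintegral_cst// mul0r. Qed.

Lemma bmeas_integrable f : bmeas f ->
  mu.-integrable D (EFin \o (fun x => complex.Re (f x))) /\
  mu.-integrable D (EFin \o (fun x => complex.Im (f x))).
Proof.
move=> [f1 f2 [M fM]]; split; apply: measurable_bounded_integrable => //;
  exists M; split; rewrite ?num_real// => N MN x Dx /=;
  rewrite (le_trans _ (ltW MN))// (le_trans _ (fM _ Dx))//;
  [exact: Re_le_nc|exact: Im_le_nc].
Qed.

Lemma eq_cint f g : (forall x, D x -> f x = g x) -> cint f = cint g.
Proof.
move=> fg; rewrite /cint; congr (_ +i* _); apply: eq_Rintegral => x xD;
  by rewrite fg//; exact/set_mem.
Qed.

Lemma cintD f g : bmeas f -> bmeas g ->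
  cint (fun x => f x + g x) = cint f + cint g.
Proof.
move=> /bmeas_integrable[f1 f2] /bmeas_integrable[g1 g2].
rewrite /cint; under eq_Rintegral do rewrite cReD.
under [X in _ +i* X = _]eq_Rintegral do rewrite cImD.
by rewrite !RintegralD.
Qed.

Lemma cintZ c f : bmeas f -> cint (fun x => c * f x) = c * cint f.
Proof.
move=> /bmeas_integrable[f1 f2]; rewrite /cint.
have iZ (r : R) (g : S -> R) : mu.-integrable D (EFin \o g) ->
    mu.-integrable D (EFin \o (fun x => r * g x)).
  by move=> ig; exact: (integrableZl mD r ig).
under eq_Rintegral do rewrite cReM.
under [X in _ +i* X = _]eq_Rintegral do rewrite cImM.
rewrite (RintegralB mD (iZ _ _ f1) (iZ _ _ f2)) (RintegralD mD (iZ _ _ f2) (iZ _ _ f1)).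
by rewrite !RintegralZl//; case: c.
Qed.

Lemma cint_sum (I : Type) (r : seq I) (P : pred I) (F : I -> S -> R[i]) :
    (forall i, P i -> bmeas (F i)) ->
  cint (fun x => \sum_(i <- r | P i) F i x) = \sum_(i <- r | P i) cint (F i).
Proof.
move=> hF; elim: r => [|i r IH].
  under eq_cint do rewrite big_nil.
  by rewrite big_nil /cint !Rintegral0.
rewrite big_cons; case: ifP => Pi.
  rewrite -IH -cintD; [|exact: hF|exact: bmeas_sum].
  by apply: eq_cint => x _; rewrite big_cons Pi.
by rewrite -IH; apply: eq_cint => x _; rewrite big_cons Pi.
Qed.

Lemma cint_conj f : bmeas f -> cint (fun x => cj (f x)) = cj (cint f).
Proof.
move=> /bmeas_integrable[f1 f2]; rewrite /cint /=.
have e (z : R[i]) : complex.Re (cj z) = complex.Re z /\ complex.Im (cj z) = -1 * complex.Im z.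
  by case: z => a b; rewrite mulN1r.
under eq_Rintegral do rewrite (e _).1.
under [X in _ +i* X = _]eq_Rintegral do rewrite (e _).2.
by rewrite RintegralZl// mulN1r.
Qed.

Lemma cint_ge0 f : (forall x, D x -> 0 <= f x) -> 0 <= cint f.
Proof.
move=> f0; rewrite lecE /=; apply/andP; split; last first.
  by apply: Rintegral_ge0 => x /f0; rewrite lecE => /andP[].
apply/eqP; transitivity (\int[mu]_(x in D) (0 : R)); last by rewrite Rintegral0.
by apply: eq_Rintegral => x /set_mem/f0; rewrite lecE => /andP[/eqP].
Qed.

(** Uniform in [f], so that all moments of a polynomial have a common bound. *)
Lemma cint_bounded (M : R) : exists B, forall f, bmeas f ->
  (forall x, D x -> nc (f x) <= M) -> nc (cint f) <= B.
Proof.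
exists (2 * (`|M| * fine (mu D))) => f mf fM.
have h (g : S -> R) : (forall x, D x -> `|g x| <= M) ->
    mu.-integrable D (EFin \o g) -> `|\int[mu]_(x in D) g x| <= `|M| * fine (mu D).
  move=> gM ig; apply: le_trans (le_normr_Rintegral _ _) _ => //.
  rewrite -Rintegral_cst//; apply: le_Rintegral => //.
  - exact: integrable_norm.
  - apply: measurable_bounded_integrable => //.
    by exists `|M|; split; rewrite ?num_real// => N /ltW MN x _ /=; rewrite normr_id.
  - by move=> x Dx; rewrite (le_trans (gM _ Dx))// ler_norm.
have [h1 h2] := bmeas_integrable mf.
have := h _ _ h1; have := h _ _ h2.
move=> /(_ (fun x Dx => le_trans (Im_le_nc _) (fM x Dx))) k2.
move=> /(_ (fun x Dx => le_trans (Re_le_nc _) (fM x Dx))) k1.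
set a := cint f; rewrite (complexE a) (le_trans (le_normcD _ _))//.
rewrite Normc.normcM mulr2n mulrDl mul1r; apply: lerD.
  by rewrite /= expr0n addr0 sqrtr_sqr.
by rewrite /= !expr0n/= expr1n add0r addr0 sqrtr1 mul1r sqrtr_sqr.
Qed.

End ComplexIntegral.

(** * Integration over the circle and the torus *)

Section Torus.
Variable R : realType.
Local Notation leb := (@lebesgue_measure R).
Local Notation TR := (measurableTypeR R).
Local Notation leb2 := (leb \x leb)%E.

Definition turn : set TR := `[0, 2 * pi].
Definition square : set (TR * TR) := turn `*` turn.

Lemma turn_meas : measurable turn. Proof. exact: measurable_itv. Qed.

Lemma twopi_gt0 : 0 < 2 * pi :> R. Proof. by rewrite mulr_gt0// pi_gt0. Qed.

Lemma leb_turn : leb turn = (2 * pi)%:E.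
Proof. by rewrite /turn lebesgue_measure_itv/= lte_fin twopi_gt0 -EFinB subr0. Qed.

Lemma leb_turn_fin : (leb turn < +oo)%E. Proof. by rewrite leb_turn ltry. Qed.

Lemma square_meas : measurable square.
Proof. exact: measurableX turn_meas turn_meas. Qed.

Lemma leb2_square : leb2 square = ((2 * pi) ^+ 2)%:E.
Proof.
rewrite product_measure1E; [|exact: turn_meas..].
transitivity (leb turn * leb turn)%E; first by [].
by rewrite leb_turn -EFinM.
Qed.

Lemma leb2_square_fin : (leb2 square < +oo)%E.
Proof. by rewrite leb2_square ltry. Qed.

Lemma cint_eq0 d (S : measurableType d) (mu : {measure set S -> \bar R}) (D : set S)
    (f : S -> R[i]) : measurable D -> (mu D < +oo)%E -> bmeas D f -> cint mu D f = 0 ->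
  (\int[mu]_(x in D) (complex.Re (f x))%:E = 0 /\
   \int[mu]_(x in D) (complex.Im (f x))%:E = 0)%E.
Proof.
move=> mD fD bf; have [i1 i2] := bmeas_integrable mD fD bf.
rewrite /cint => -[]; rewrite /Rintegral => h1 h2; split.
- by rewrite -[LHS]fineK ?h1// integrable_fin_num.
- by rewrite -[LHS]fineK ?h2// integrable_fin_num.
Qed.

(** Fubini's theorem, in the only form that is needed below. *)
Lemma square_slices_eq0 (f : TR * TR -> R) :
    leb2.-integrable square (EFin \o f) ->
    (forall s, turn s -> \int[leb]_(t in turn) (f (s, t))%:E = 0)%E \/
    (forall t, turn t -> \int[leb]_(s in turn) (f (s, t))%:E = 0)%E ->
  \int[leb2]_(x in square) f x = 0.
Proof.
move=> fi h; rewrite /Rintegral integral_mkcond.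
have fi' : leb2.-integrable setT ((EFin \o f) \_ square).
  by have [h1 _] := integrable_mkcond (mu := leb2) (EFin \o f) square_meas; exact: h1.
case: h => h.
- rewrite -(integral12_prod_meas1 fi') integral0_eq// => s _; rewrite /fubini_F.
  have [ts|ts] := pselect (turn s).
    rewrite -[RHS](h s ts) [RHS]integral_mkcond; apply: eq_integral => t _.
    rewrite !patchE; congr (if _ then _ else _).
    by apply/idP/idP => /set_mem => [[_ ?]|?]; apply/mem_set.
  by rewrite integral0_eq// => t _; rewrite patchE memNset// => -[].
- rewrite -(integral21_prod_meas1 fi') integral0_eq// => t _; rewrite /fubini_G.
  have [tt|tt] := pselect (turn t).
    rewrite -[RHS](h t tt) [RHS]integral_mkcond; apply: eq_integral => s _.
    rewrite !patchE; congr (if _ then _ else _).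
    by apply/idP/idP => /set_mem => [[? _]|?]; apply/mem_set.
  by rewrite integral0_eq// => s _; rewrite patchE memNset// => -[].
Qed.

Lemma cint_slices_eq0 (f : TR * TR -> R[i]) : bmeas square f ->
    (forall s, turn s -> bmeas turn (fun t => f (s, t)) /\
       cint leb turn (fun t => f (s, t)) = 0) \/
    (forall t, turn t -> bmeas turn (fun s => f (s, t)) /\
       cint leb turn (fun s => f (s, t)) = 0) ->
  cint leb2 square f = 0.
Proof.
move=> bf h.
have [i1 i2] := bmeas_integrable square_meas leb2_square_fin bf.
have h0 g := @cint_eq0 _ _ leb turn g turn_meas leb_turn_fin.
rewrite /cint !square_slices_eq0//.
- by case: h => h; [left|right] => s /h[b /(h0 _ b)[]].
- by case: h => h; [left|right] => s /h[b /(h0 _ b)[]].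
Qed.

Lemma circ_mulJ (t : R) : circ t * cj (circ t) = 1.
Proof.
by rewrite /circ; simpc; rewrite -!expr2 cos2Dsin2 [_ + _]addrC mulrC subrr.
Qed.

Lemma nc_circ (t : R) : nc (circ t) = 1.
Proof. by rewrite /circ /= cos2Dsin2 sqrtr1. Qed.

Lemma circ_neq0 (t : R) : circ t != 0.
Proof. by apply: contra_eq_neq (circ_mulJ t) => ->; rewrite mul0r eq_sym oner_neq0. Qed.

Lemma circV (t : R) : (circ t)^-1 = cj (circ t).
Proof. by apply: (mulfI (circ_neq0 t)); rewrite circ_mulJ divff ?circ_neq0. Qed.

Lemma normr_circ (t : R) : `|circ t| = 1.
Proof. by rewrite -(rmorph1 (real_complex R)) -(nc_circ t). Qed.

Lemma circX (t : R) k : circ t ^+ k = cos (k%:R * t) +i* sin (k%:R * t).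
Proof.
elim: k => [|k IH]; first by rewrite mul0r cos0 sin0.
rewrite exprS IH /circ -natr1 (mulrDl _ _ t) mul1r cosD sinD; simpc.
by congr (_ +i* _); ring.
Qed.

Lemma periodic_nat (f : R -> R) k : periodic f (pi *+ 2) -> f (k%:R * (2 * pi)) = f 0.
Proof.
move=> pf; rewrite -[RHS](periodicn pf k) add0r; congr f.
by rewrite mulr_natl mulr_natl.
Qed.

(** The primitives are periodic. *)
Lemma int_cos (k : nat) : (0 < k)%N ->
  (\int[leb]_(t in turn) (cos (k%:R * t))%:E = 0)%E /\
  (\int[leb]_(t in turn) (sin (k%:R * t))%:E = 0)%E.
Proof.
move=> k0; have k0' : k%:R != 0 :> R by rewrite pnatr_eq0 -lt0n.
have ck : continuous (fun t : R => k%:R * t) by exact: mulrl_continuous.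
have cc : continuous (fun t : R => cos (k%:R * t)).
  by move=> t; apply: continuous_comp; [exact: ck|exact: continuous_cos].
have cs : continuous (fun t : R => sin (k%:R * t)).
  by move=> t; apply: continuous_comp; [exact: ck|exact: continuous_sin].
have ds (t : R) : is_derive t 1 (fun t : R => k%:R^-1 * sin (k%:R * t)) (cos (k%:R * t)).
  by apply: is_derive_eq; rewrite /GRing.scale/=; field.
have dc (t : R) : is_derive t 1 (fun t : R => - k%:R^-1 * cos (k%:R * t)) (sin (k%:R * t)).
  by apply: is_derive_eq; rewrite /GRing.scale/=; field.
have FTC (f F : R -> R) : continuous f -> (forall t : R, is_derive t 1 F (f t)) ->
    F (2 * pi) = F 0 -> (\int[leb]_(t in turn) (f t)%:E = 0)%E.
  move=> cf dF eF; rewrite /turn (@continuous_FTC2 _ f F)//.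
  - by rewrite eF subee.
  - exact: twopi_gt0.
  - exact: continuous_subspaceT.
  - have cF : continuous F by move=> t; apply/differentiable_continuous/derivable1_diffP.
    split=> [t _|//|]; [exact: ex_derive|exact: cvg_at_right_filter (cF _)|
      exact: cvg_at_left_filter (cF _)].
  - by move=> t _; rewrite derive1E; exact: derive_val.
split.
- apply: (FTC _ _ cc ds); rewrite (periodic_nat _ (@sinD2pi R)) mulr0//.
- apply: (FTC _ _ cs dc); rewrite (periodic_nat _ (@cosD2pi R)) mulr0//.
Qed.

End Torus.

(** * Evaluation of polynomials in two variables *)

Section Evaluation.
Variable R : realType.
Implicit Types (f g : bipoly R) (z w : R[i]).

Lemma evE f z w : ev f z w = \sum_(t < size f) (f`_t).[z] * w ^+ t.
Proof.
rewrite /ev (horner_coef f) horner_sum; apply: eq_bigr => t _.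
by rewrite hornerM horner_exp hornerC.
Qed.

Lemma evD f g z w : ev (f + g) z w = ev f z w + ev g z w.
Proof. by rewrite /ev !hornerD. Qed.
Lemma evM f g z w : ev (f * g) z w = ev f z w * ev g z w.
Proof. by rewrite /ev !hornerM. Qed.
Lemma evN f z w : ev (- f) z w = - ev f z w.
Proof. by rewrite /ev !hornerN. Qed.
Lemma ev_sum (I : Type) (r : seq I) (P : pred I) (F : I -> bipoly R) z w :
  ev (\sum_(i <- r | P i) F i) z w = \sum_(i <- r | P i) ev (F i) z w.
Proof. by rewrite /ev !horner_sum. Qed.
Lemma evXn k z w : ev ('X^k : bipoly R) z w = w ^+ k.
Proof. by rewrite /ev hornerXn horner_exp hornerC. Qed.
Lemma evC (q : {poly R[i]}) z w : ev q%:P z w = q.[z].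
Proof. by rewrite /ev hornerC. Qed.

(** Induction principle: continuity and measurability of a polynomial expression
    both follow from closure under the ring operations. *)
Lemma ev_closed (S : Type) (P : (S -> R[i]) -> Prop) (u v : S -> R[i]) f :
    (forall c, P (fun=> c)) -> (forall a b, P a -> P b -> P (fun x => a x + b x)) ->
    (forall a b, P a -> P b -> P (fun x => a x * b x)) -> P u -> P v ->
  P (fun x => ev f (u x) (v x)).
Proof.
move=> Pc PD PM Pu Pv.
have PX (a : S -> R[i]) k : P a -> P (fun x => a x ^+ k).
  move=> Pa; elim: k => [|k IH]; first exact: Pc.
  by under eq_fun do rewrite exprS; exact: PM.
have Ps (N : nat) (F : nat -> S -> R[i]) :
    (forall i, P (F i)) -> P (fun x => \sum_(i < N) F i x).
  move=> PF; elim: N => [|N IH].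
    by under eq_fun do rewrite big_ord0; exact: Pc.
  by under eq_fun do rewrite big_ord_recr; exact: PD.
under eq_fun do rewrite evE.
apply: (Ps _ (fun t x => (f`_t).[u x] * v x ^+ t)) => t; apply: (PM); last exact: PX.
under eq_fun do rewrite horner_coef.
apply: (Ps _ (fun s x => (f`_t)`_s * u x ^+ s)) => s.
by apply: PM; [exact: Pc|exact: PX].
Qed.

(** The inverse of the squared modulus is continuous on a compact square, hence
    bounded. *)
Lemma torus_lower_bound (p : bipoly R) :
    (forall s t : R, ev p (circ s) (circ t) != 0) ->
  exists2 e : R, 0 < e & forall x, square (R := R) x -> e <= nc (ev p (circ x.1) (circ x.2)).
Proof.
move=> hp.
pose cont (f : R * R -> R[i]) := continuous (fun x => complex.Re (f x)) /\
   continuous (fun x => complex.Im (f x)).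
pose F (x : R * R) := ev p (circ x.1) (circ x.2).
have [cRe cIm] : cont F.
  apply: ev_closed.
  - by move=> c; split=> x; exact: cvg_cst.
  - move=> a b [a1 a2] [b1 b2]; split.
      by under eq_fun do rewrite cReD; move=> x; apply: cvgD; [exact: a1|exact: b1].
    by under eq_fun do rewrite cImD; move=> x; apply: cvgD; [exact: a2|exact: b2].
  - move=> a b [a1 a2] [b1 b2]; split.
      under eq_fun do rewrite cReM.
      move=> x; apply: cvgB; apply: cvgM; by [exact: a1|exact: b1|exact: a2|exact: b2].
    under eq_fun do rewrite cImM.
    move=> x; apply: cvgD; apply: cvgM; by [exact: a1|exact: b1|exact: a2|exact: b2].
  - by split=> x; apply: continuous_comp; [exact: cvg_fst|exact: continuous_cos|
      exact: cvg_fst|exact: continuous_sin].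
  - by split=> x; apply: continuous_comp; [exact: cvg_snd|exact: continuous_cos|
      exact: cvg_snd|exact: continuous_sin].
pose h x := complex.Re (F x) ^+ 2 + complex.Im (F x) ^+ 2.
have h0 x : 0 < h x.
  rewrite lt0r addr_ge0 ?sqr_ge0// andbT; apply: contra (hp x.1 x.2).
  rewrite paddr_eq0 ?sqr_ge0// !sqrf_eq0 -/(F x) => /andP[/eqP re /eqP im].
  by rewrite (complexE (F x)) re im mulr0 addr0.
have ch : continuous (fun x => (h x)^-1).
  move=> x; apply: cvgV; first by rewrite gt_eqF.
  by apply: cvgD; under eq_fun do rewrite expr2; apply: cvgM; by [exact: cRe|exact: cIm].
have cpt : compact (`[0, 2 * pi] `*` `[0, 2 * pi] : set (R * R)).
  by apply: compact_setX; exact: segment_compact.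
have /compact_bounded[M [_ hM]] := continuous_compact (continuous_subspaceT ch) cpt.
have := hM (`|M| + 1) _; rewrite (le_lt_trans (ler_norm M)) ?ltrDl// => /(_ isT) {}hM.
have K0 : 0 < `|M| + 1 by rewrite ltr_wpDl.
exists (Num.sqrt (`|M| + 1)^-1); first by rewrite sqrtr_gt0 invr_gt0.
move=> x hx; have hle : `|(h x)^-1| <= `|M| + 1 by apply: hM; exists x.
rewrite ger0_norm ?invr_ge0 ?(ltW (h0 x))// in hle.
have -> : nc (ev p (circ x.1) (circ x.2)) = Num.sqrt (h x).
  by rewrite /h /F; case: (ev _ _ _).
by rewrite ler_wsqrtr// -[h x]invrK lef_pV2 ?posrE ?invr_gt0.
Qed.

End Evaluation.

(** * The mean over the torus *)

Section TorusMean.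
Variable R : realType.
Local Notation leb := (@lebesgue_measure R).
Local Notation leb2 := (leb \x leb)%E.
Local Notation TR := (measurableTypeR R).
Local Notation turn := (@turn R).
Local Notation square := (@square R).
Implicit Types (f g : TR * TR -> R[i]) (c : R[i]).

Lemma cjX (z : R[i]) k : cj (z ^+ k) = cj z ^+ k.
Proof. exact: rmorphXn. Qed.

Lemma bmeas_circ d (S : measurableType d) (D : set S) (u : S -> TR) :
  measurable_fun setT u -> bmeas D (fun x => circ (u x : R)).
Proof.
move=> mu; split; last by exists 1 => x _; rewrite nc_circ.
- apply: measurable_funTS; apply: (measurableT_comp (f := @cos R)) => //.
  exact: continuous_measurable_fun (@continuous_cos R).
- apply: measurable_funTS; apply: (measurableT_comp (f := @sin R)) => //.
  exact: continuous_measurable_fun (@continuous_sin R).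
Qed.

Lemma bmeas_exprz d (S : measurableType d) (D : set S) (u : S -> TR) (i : int) :
  measurable_fun setT u -> bmeas D (fun x => circ (u x : R) ^ i).
Proof.
move=> mu; have bu := bmeas_circ D mu.
case: i => k; first exact: bmeasX.
apply: (bmeas_ext (f := fun x => cj (circ (u x : R)) ^+ k.+1)) => [x|].
  by rewrite NegzE -exprnN -circV exprVn.
exact/bmeasX/bmeas_conj.
Qed.

Lemma circle_monomial k : cint leb turn (fun t => circ t ^+ k.+1) = 0.
Proof.
have [h1 h2] := @int_cos R k.+1 isT.
rewrite /cint; under eq_Rintegral do rewrite circX/=.
under [X in _ +i* X]eq_Rintegral do rewrite circX/=.
by rewrite /Rintegral h1 h2.
Qed.

Lemma circle_monomialz (i : int) : i != 0 -> cint leb turn (fun t => circ t ^ i) = 0.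
Proof.
case: i => [[|k] //|k] _; first exact: circle_monomial.
rewrite -(conjcK (cint _ _ _)) -(rmorph0 cj) -(circle_monomial k); congr cj.
rewrite -(cint_conj (@turn_meas R) (@leb_turn_fin R)); last exact/bmeas_exprz.
apply: eq_cint => t _; rewrite NegzE -exprnN conjc_inv cjX.
by rewrite -circV exprVn invrK.
Qed.

(** The integrals of [z^k / q] over the circle are bounded in [k] and satisfy the
    recurrence with characteristic polynomial [q], since those of [z^k] vanish for
    [k >= 1]. *)
Lemma circle_vanish (q : {poly R[i]}) k :
    (forall z : R[i], `|z| <= 1 -> q.[z] != 0) ->
  bmeas turn (fun t => circ t ^+ k.+1 / q.[circ t]) /\
  cint leb turn (fun t => circ t ^+ k.+1 / q.[circ t]) = 0.
Proof.
move=> hq; have bc : bmeas turn (@circ R) by exact: bmeas_circ.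
have bp (r : {poly R[i]}) : bmeas turn (fun t => r.[circ t]).
  under eq_fun do rewrite horner_coef.
  apply: bmeas_sum => l _; apply: bmeasM; [exact: bmeas_cst|exact: bmeasX].
have [e e0 he] : exists2 e : R, 0 < e & forall t, turn t -> e <= nc q.[circ t].
  have evq z w : ev (map_poly polyC q) z w = q.[w].
    by rewrite /ev horner_map/= hornerC.
  have [|e e0 he] := @torus_lower_bound R (map_poly polyC q).
    by move=> s t; rewrite evq hq// normr_circ.
  exists e => // t tt; rewrite -(evq (circ 0)); apply: (he (0, t)).
  split=> //=; rewrite /turn /= in_itv/= lexx; exact/ltW/twopi_gt0.
have bV : bmeas turn (fun t => q.[circ t]^-1) := bmeas_inv e0 he (bp q).
have bx j : bmeas turn (fun t => circ t ^+ j / q.[circ t]).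
  by apply: bmeasM => //; exact: bmeasX.
split=> //.
pose x k := cint leb turn (fun t => circ t ^+ k.+1 / q.[circ t]).
have [B hB] := @cint_bounded _ _ _ leb turn (@turn_meas R) (@leb_turn_fin R) e^-1.
apply: (@bounded_recurrence_eq0 R q x B) => // j.
  apply: hB => // t tt; rewrite Normc.normcM Normc.normcV.
  have -> : nc (circ t ^+ j.+1) = 1.
    by elim: j => [|j IH]; rewrite ?expr1 ?nc_circ// exprS Normc.normcM IH nc_circ mul1r.
  by rewrite mul1r lef_pV2 ?posrE ?he//; exact: lt_le_trans (he _ tt).
rewrite /recur -[RHS](circle_monomial j).
under eq_bigr do rewrite -(cintZ (@turn_meas R) (@leb_turn_fin R) _)//.
rewrite -(cint_sum (@turn_meas R) (@leb_turn_fin R)); last first.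
  by move=> l _; apply: bmeasM => //; exact: bmeas_cst.
apply: eq_cint => t tt.
have q0 : q.[circ t] != 0 by rewrite hq// normr_circ.
rewrite -[RHS](mulfK q0) [in X in _ = _ * X / _]horner_coef mulr_sumr mulr_suml.
by apply: eq_bigr => l _; rewrite -addSn exprD; ring.
Qed.

Definition mean f : R[i] := (((2 * pi) ^+ 2)^-1)%:C * cint leb2 square f.

Local Notation bm := (bmeas square).
Local Notation mS := (@square_meas R).
Local Notation fS := (@leb2_square_fin R).

Lemma eq_mean f g : (forall x, f x = g x) -> mean f = mean g.
Proof. by move=> fg; congr (_ * _); apply: eq_cint => x _. Qed.

Lemma meanD f g : bm f -> bm g -> mean (fun x => f x + g x) = mean f + mean g.
Proof. by move=> bf bg; rewrite /mean (cintD mS fS bf bg) mulrDr. Qed.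

Lemma meanZ c f : bm f -> mean (fun x => c * f x) = c * mean f.
Proof. by move=> bf; rewrite /mean (cintZ mS fS c bf) mulrCA. Qed.

Lemma meanB f g : bm f -> bm g -> mean (fun x => f x - g x) = mean f - mean g.
Proof.
move=> bf bg; rewrite -mulN1r -meanZ// -meanD//.
  by apply: eq_mean => x; rewrite mulN1r.
by apply: bmeasM => //; exact: bmeas_cst.
Qed.

Lemma mean_sum (I : Type) (r : seq I) (P : pred I) (F : I -> TR * TR -> R[i]) :
    (forall i, P i -> bm (F i)) ->
  mean (fun x => \sum_(i <- r | P i) F i x) = \sum_(i <- r | P i) mean (F i).
Proof. by move=> bF; rewrite /mean (cint_sum mS fS)// mulr_sumr. Qed.

Lemma mean_conj f : bm f -> mean (fun x => cj (f x)) = cj (mean f).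
Proof. by move=> bf; rewrite /mean (cint_conj mS fS)// rmorphM/= oppr0. Qed.

Lemma mean_ge0 f : (forall x, square x -> 0 <= f x) -> 0 <= mean f.
Proof.
move=> f0; rewrite mulr_ge0//; last by apply: cint_ge0 => //; exact: mS.
by rewrite ler0c invr_ge0 exprn_ge0// ltW// twopi_gt0.
Qed.

Lemma mean_bounded (M : R) : exists B, forall f, bm f ->
  (forall x, square x -> nc (f x) <= M) -> nc (mean f) <= B.
Proof.
have [B hB] := cint_bounded mS fS M.
exists (nc (((2 * pi) ^+ 2)^-1)%:C * B) => f bf fM.
by rewrite /mean Normc.normcM ler_wpM2l ?nc_ge0 ?hB.
Qed.

(** Locked, so that the rewriting rules for products do not apply inside. *)
Definition mono (i j : int) (x : TR * TR) : R[i] :=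
  locked (circ (x.1 : R) ^ i * circ (x.2 : R) ^ j).

Lemma monoE i j x : mono i j x = circ (x.1 : R) ^ i * circ (x.2 : R) ^ j.
Proof. by rewrite /mono -lock. Qed.

Lemma bm_mono i j : bm (mono i j).
Proof.
apply: (bmeas_ext (f := fun x => circ (x.1 : R) ^ i * circ (x.2 : R) ^ j)) => [x|].
  by rewrite monoE.
by apply: bmeasM; apply: bmeas_exprz; [exact: measurable_fst|exact: measurable_snd].
Qed.

Lemma monoM i j k l x : mono i j x * mono k l x = mono (i + k) (j + l) x.
Proof. by rewrite !monoE !expfzDr ?circ_neq0//; ring. Qed.

Lemma circ_conj_exprz (t : R) i : cj (circ t ^ i) = circ t ^ (- i).
Proof.
case: i => k.
  by rewrite -exprnN -exprVn circV; exact: (cjX (circ t) k).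
by rewrite NegzE opprK -exprnN conjc_inv cjX -circV exprVn invrK.
Qed.

Lemma mono_conj i j x : cj (mono i j x) = mono (- i) (- j) x.
Proof. by rewrite !monoE rmorphM/= !circ_conj_exprz. Qed.

Lemma mono0 x : mono 0 0 x = 1.
Proof. by rewrite monoE !expr0z mulr1. Qed.

Lemma mono_mulJ i j x : mono i j x * cj (mono i j x) = 1.
Proof. by rewrite mono_conj monoM !subrr mono0. Qed.

Lemma nc_mono i j x : nc (mono i j x) = 1.
Proof.
have : nc (mono i j x) * nc (mono i j x) = 1.
  by rewrite -[X in _ * X]nc_conj -Normc.normcM mono_mulJ Normc.normc1.
by move/eqP; rewrite -expr2 sqrf_eq1 => /orP[/eqP//|/eqP h];
  have := nc_ge0 (mono i j x); rewrite h; lra.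
Qed.

Lemma mean1 : mean (fun=> 1) = 1.
Proof.
have e : fine (leb2 square) = (2 * pi) ^+ 2 by rewrite leb2_square.
transitivity ((((2 * pi) ^+ 2)^-1)%:C * ((2 * pi) ^+ 2)%:C : R[i]).
  congr (_ * _); rewrite /cint; congr (_ +i* _).
    by rewrite (Rintegral_cst _ mS) mul1r.
  by rewrite (Rintegral_cst _ mS) mul0r.
rewrite -rmorphM mulVf; first by rewrite rmorph1.
by rewrite sqrf_eq0 gt_eqF// twopi_gt0.
Qed.

Lemma mean_mono i j : mean (mono i j) = ((i == 0) && (j == 0))%:R.
Proof.
have [->|j0] := eqVneq j 0; last first.
  rewrite andbF /mean cint_slices_eq0 ?mulr0//; first exact: bm_mono.
  left=> s _; have bj : bmeas turn (fun t => circ t ^ j) by exact: bmeas_exprz.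
  have e : (fun t => mono i j (s, t)) = (fun t => circ (s : R) ^ i * circ (t : R) ^ j).
    by apply/funext => t; rewrite monoE.
  rewrite e; split; first by apply: bmeasM => //; exact: bmeas_cst.
  by rewrite (cintZ (@turn_meas R) (@leb_turn_fin R) _)// circle_monomialz ?mulr0.
have [->|i0] := eqVneq i 0; last first.
  rewrite /mean cint_slices_eq0 ?mulr0//; first exact: bm_mono.
  right=> t _; have bi : bmeas turn (fun s => circ s ^ i) by exact: bmeas_exprz.
  have e : (fun s => mono i 0 (s, t)) = (fun s => circ (s : R) ^ i).
    by apply/funext => s; rewrite monoE/= expr0z mulr1.
  by rewrite e; split => //; exact: circle_monomialz.
by rewrite -[RHS]mean1; apply: eq_mean => x; rewrite mono0.
Qed.

End TorusMean.

(** * Means of quotients by p *)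

Lemma divX_of_coef0 (A : nzRingType) (f : {poly A}) :
  f`_0 = 0 -> f = 'X * drop_poly 1 f.
Proof.
move=> f0; rewrite -[LHS](poly_take_drop 1) expr1 -[in RHS]commr_polyX.
rewrite [X in X + _](_ : _ = 0) ?add0r//.
by apply/polyP => -[|j]; rewrite coef_take_poly ?coef0.
Qed.

Section Weighted.
Variable R : realType.
Local Notation TR := (measurableTypeR R).
Local Notation bm := (bmeas (@square R)).
Implicit Types (f g : bipoly R) (x : TR * TR).

Definition evx f x : R[i] := ev f (circ (x.1 : R)) (circ (x.2 : R)).

(** Exclusive degree bounds, so that [box 0 M] is the zero space. *)
Definition box (N M : nat) f := (size f <= M)%N /\ forall t, (size (f`_t)%R <= N)%N.

Lemma box_exists f : exists N M, box N.+1 M.+1 f.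
Proof.
exists (\max_(t < size f) size (f`_t)%R)%N, (size f); split=> // t.
have [h|h] := ltnP t (size f); last by rewrite nth_default// size_poly0.
by rewrite leqW// (leq_bigmax (Ordinal h)).
Qed.

Lemma PspaceP N M f : Pspace (N%:Z - 1) (M%:Z - 1) f <-> box N M f.
Proof.
split=> [h|[h1 h2] s t c0].
  have cf s t : (f`_t)`_s != 0 -> (s < N)%N /\ (t < M)%N.
    by move=> /h[]; lia.
  split=> [|t].
    apply/leq_sizeP => t Mt; apply/polyP => s; rewrite coef0.
    by apply/eqP; apply: contraTT Mt => /cf[_]; rewrite -ltnNge.
  by apply/leq_sizeP => s Ns; apply/eqP; apply: contraTT Ns => /cf[]; rewrite -ltnNge.
have ht : (t < M)%N.
  by apply: contraNT c0; rewrite -leqNgt => h;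
    rewrite (_ : f`_t = 0) ?coef0// nth_default// (leq_trans h1).
have hs : (s < N)%N.
  by apply: contraNT c0; rewrite -leqNgt => h; rewrite (nth_default _ (leq_trans (h2 t) h)).
lia.
Qed.

Lemma ev_box N M f (z w : R[i]) : box N M f ->
  ev f z w = \sum_(t < M) \sum_(s < N) (f`_t)`_s * (z ^+ s * w ^+ t).
Proof.
move=> [h1 h2]; rewrite evE (big_ord_widen M (fun t => (f`_t).[z] * w ^+ t))//.
rewrite big_mkcond/=; apply: eq_bigr => t _; case: ltnP => ht; last first.
  by rewrite big1// => s _; rewrite (_ : f`_t = 0) ?coef0 ?mul0r// nth_default.
rewrite (horner_coef_wide _ (h2 t)) mulr_suml.
by apply: eq_bigr => s _; rewrite mulrA.
Qed.

Lemma evx_box N M f x : box N M f ->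
  evx f x = \sum_(t < M) \sum_(s < N) (f`_t)`_s * mono s%:Z t%:Z x.
Proof.
move=> h; rewrite /evx (ev_box _ _ h); apply: eq_bigr => t _; apply: eq_bigr => s _.
by rewrite monoE.
Qed.

Lemma evxD f g x : evx (f + g) x = evx f x + evx g x. Proof. exact: evD. Qed.
Lemma evxM f g x : evx (f * g) x = evx f x * evx g x. Proof. exact: evM. Qed.
Lemma evxN f x : evx (- f) x = - evx f x. Proof. exact: evN. Qed.
Lemma evx_sum (I : Type) (r : seq I) (P : pred I) (F : I -> bipoly R) x :
  evx (\sum_(i <- r | P i) F i) x = \sum_(i <- r | P i) evx (F i) x.
Proof. exact: ev_sum. Qed.
Lemma evxXn k x : evx ('X^k) x = mono 0 k%:Z x.
Proof. by rewrite /evx evXn monoE expr0z mul1r. Qed.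
Lemma evxZn k x : evx ('X^k)%:P x = mono k%:Z 0 x.
Proof. by rewrite /evx evC hornerXn monoE expr0z mulr1. Qed.
Lemma evxC (c : R[i]) x : evx c%:P%:P x = c.
Proof. by rewrite /evx evC hornerC. Qed.

Lemma bm_evx f : bm (evx f).
Proof.
apply: (@ev_closed R _ (bmeas (@square R)) (fun x => circ (x.1 : R)) (fun x => circ (x.2 : R))).
- exact: bmeas_cst.
- exact: bmeasD.
- exact: bmeasM.
- by apply: bmeas_circ; exact: measurable_fst.
- by apply: bmeas_circ; exact: measurable_snd.
Qed.

Lemma bmeasB (u v : TR * TR -> R[i]) : bm u -> bm v -> bm (fun x => u x - v x).
Proof.
move=> bu bv; apply: bmeasD => //; apply: (bmeas_ext (f := fun x => -1 * v x)).
  by move=> x; rewrite mulN1r.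
by apply: bmeasM => //; exact: bmeas_cst.
Qed.

Lemma mean_evx_mono f i j : mean (fun x => evx f x * mono i j x) =
  \sum_(t < size f) \sum_(s < size (f`_t)%R) (f`_t)`_s * ((s%:Z + i == 0) && (t%:Z + j == 0))%:R.
Proof.
have e x : evx f x * mono i j x =
    \sum_(t < size f) \sum_(s < size (f`_t)%R) (f`_t)`_s * mono (s%:Z + i) (t%:Z + j) x.
  rewrite /evx evE mulr_suml; apply: eq_bigr => t _.
  rewrite horner_coef mulr_suml mulr_suml; apply: eq_bigr => s _.
  by rewrite -monoM !monoE -!exprnP; ring.
under eq_mean do rewrite e.
have bmm (c : R[i]) k l : bm (fun x => c * mono k l x).
  by apply: bmeasM; [exact: bmeas_cst|exact: bm_mono].
rewrite mean_sum; last by move=> t _; apply: bmeas_sum => s _.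
apply: eq_bigr => t _; rewrite mean_sum//; apply: eq_bigr => s _.
by rewrite meanZ ?mean_mono//; exact: bm_mono.
Qed.

Lemma mean_coef f s t : mean (fun x => evx f x * mono (- s%:Z) (- t%:Z) x) = (f`_t)`_s.
Proof.
rewrite mean_evx_mono.
have [ht|ht] := ltnP t (size f); last first.
  rewrite (_ : f`_t = 0) ?coef0; last by rewrite nth_default.
  rewrite big1// => t' _; rewrite big1// => s' _.
  rewrite (_ : _ && _ = false) ?mulr0//; apply/negbTE; move: (ltn_ord t'); lia.
rewrite (bigD1 (Ordinal ht))//= [X in _ + X]big1 ?addr0; last first.
  move=> t' /eqP tt'; rewrite big1// => s' _.
  rewrite (_ : _ && _ = false) ?mulr0//; apply/negbTE/negP => /andP[_ /eqP h].
  by apply: tt'; apply: val_inj => /=; lia.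
have [hs|hs] := ltnP s (size (f`_t)%R); last first.
  rewrite [RHS]nth_default// big1// => s' _.
  rewrite (_ : _ && _ = false) ?mulr0//; apply/negbTE; have := leq_trans (ltn_ord s') hs; lia.
rewrite (bigD1 (Ordinal hs))//= !subrr eqxx mulr1 big1 ?addr0// => s' /eqP ss'.
rewrite (_ : _ && _ = false) ?mulr0//; apply/negbTE/negP => /andP[/eqP h _].
by apply: ss'; apply: val_inj => /=; lia.
Qed.

Lemma mean_coef_out f i j : 0 < i -> mean (fun x => evx f x * mono i j x) = 0.
Proof.
move=> i0; rewrite mean_evx_mono big1// => t _; rewrite big1// => s _.
by rewrite (_ : _ && _ = false) ?mulr0//; apply/negbTE; lia.
Qed.

(** The reflection [z^N w^M conj(f(1/conj(z), 1/conj(w)))]; on the torus it is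
    [z^N w^M conj(f)]. *)
Definition refl (N M : nat) f : bipoly R :=
  \poly_(t < M.+1) \poly_(s < N.+1) cj (f`_(M - t))`_(N - s).

Lemma evx_refl N M f x : box N.+1 M.+1 f ->
  evx (refl N M f) x = mono N%:Z M%:Z x * cj (evx f x).
Proof.
move=> bf; have bq : box N.+1 M.+1 (refl N M f).
  split=> [|t]; first exact: size_poly.
  by rewrite coef_poly; case: ifP; rewrite ?size_poly0 ?size_poly.
rewrite (evx_box _ bq) (evx_box _ bf) rmorph_sum mulr_sumr.
rewrite (reindex_inj rev_ord_inj)/=; apply: eq_bigr => t _.
rewrite rmorph_sum mulr_sumr (reindex_inj rev_ord_inj)/=; apply: eq_bigr => s _.
rewrite coef_poly !subSS ltnS leq_subr coef_poly ltnS leq_subr.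
rewrite !subKn; [|by rewrite -ltnS..].
rewrite rmorphM/=. rewrite mono_conj [RHS]mulrCA monoM; congr (_ * mono _ _ x);
  [have := ltn_ord s|have := ltn_ord t]; lia.
Qed.

Section Denominator.
Variable p : bipoly R.
Hypothesis hp : forall z w : R[i], `|z| = 1 -> `|w| <= 1 -> ev p z w != 0.

Lemma evp_neq0 x : evx p x != 0.
Proof. by rewrite hp// ?normr_circ. Qed.

Lemma bm_pinv : bm (fun x => (evx p x)^-1).
Proof.
have [|e e0 he] := @torus_lower_bound R p; first by move=> s t; rewrite hp// normr_circ.
exact: bmeas_inv e0 he (bm_evx p).
Qed.

(** For fixed [z], this is [circle_vanish] for the polynomial [p(z, .)]. *)
Lemma mono_over_p (i : int) (k : nat) : mean (fun x => mono i k.+1%:Z x / evx p x) = 0.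
Proof.
rewrite /mean cint_slices_eq0 ?mulr0//.
  by apply: bmeasM; [exact: bm_mono|exact: bm_pinv].
left=> s ts.
pose q : {poly R[i]} := map_poly (horner_eval (circ s)) p.
have evq w : q.[w] = ev p (circ s) w.
  rewrite /q /ev -[w in LHS](hornerC w (circ s)) -/(horner_eval (circ s) w%:P).
  by rewrite horner_map.
have [|b h] := @circle_vanish R q k; first by move=> w w1; rewrite evq hp// normr_circ.
have e : (fun t : TR => mono i k.+1%:Z (s, t) / evx p (s, t))
    = (fun t => circ s ^ i * (circ (t : R) ^+ k.+1 / q.[circ (t : R)])).
  by apply/funext => t; rewrite evq monoE mulrA.
rewrite e; split; first by apply: bmeasM => //; exact: bmeas_cst.
by rewrite (cintZ (@turn_meas R) (@leb_turn_fin R) _)// h mulr0.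
Qed.

Lemma mean_over_p_shift f (i : int) : mean (fun x => mono i 1 x * evx f x / evx p x) = 0.
Proof.
have [N [M bf]] := box_exists f.
have e x : mono i 1 x * evx f x / evx p x = \sum_(t < M.+1) \sum_(s < N.+1)
    (f`_t)`_s * (mono (s%:Z + i) t.+1%:Z x / evx p x).
  rewrite (evx_box _ bf) mulr_sumr mulr_suml; apply: eq_bigr => t _.
  rewrite mulr_sumr mulr_suml; apply: eq_bigr => s _.
  by rewrite -[t.+1]addn1 PoszD -monoM; ring.
have b (t : nat) (s : nat) : bm (fun x => mono (s%:Z + i) t.+1%:Z x / evx p x).
  by apply: bmeasM; [exact: bm_mono|exact: bm_pinv].
under eq_mean do rewrite e.
rewrite mean_sum; last first.
  by move=> t _; apply: bmeas_sum => s _; apply: bmeasM => //; exact: bmeas_cst.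
rewrite big1// => t _; rewrite mean_sum; last first.
  by move=> s _; apply: bmeasM => //; exact: bmeas_cst.
by rewrite big1// => s _; rewrite meanZ// mono_over_p mulr0.
Qed.

(** The rest of [f] is divisible by [w]. *)
Lemma mean_over_p_const f (i : int) : mean (fun x => mono i 0 x * evx f x / evx p x)
  = mean (fun x => mono i 0 x * evx (f`_0)%:P x / evx p x).
Proof.
have fE : f = (f`_0)%:P + 'X * drop_poly 1 f.
  rewrite -[LHS](poly_take_drop 1) expr1 [_ * 'X]mulrC; congr (_ + _).
  by apply/polyP => -[|j]; rewrite coef_take_poly coefC//.
transitivity (mean (fun x => mono i 0 x * evx (f`_0)%:P x / evx p x
    + mono i 1 x * evx (drop_poly 1 f) x / evx p x)).
  apply: eq_mean => x; rewrite {1}fE evxD evxM -(expr1 'X) evxXn.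
  have -> : mono i 1 x = mono i 0 x * mono 0 1 x by rewrite monoM addr0 add0r.
  by ring.
have b (g : bipoly R) (k : int) : bm (fun x => mono i k x * evx g x / evx p x).
  by apply: bmeasM; [apply: bmeasM; [exact: bm_mono|exact: bm_evx]|exact: bm_pinv].
by rewrite meanD// mean_over_p_shift addr0.
Qed.

End Denominator.
End Weighted.


Lemma cjM (R : realType) (a b : R[i]) : cj (a * b) = cj a * cj b.
Proof. exact: rmorphM. Qed.
Lemma cjD (R : realType) (a b : R[i]) : cj (a + b) = cj a + cj b.
Proof. exact: rmorphD. Qed.
Lemma cjB (R : realType) (a b : R[i]) : cj (a - b) = cj a - cj b.
Proof. exact: rmorphB. Qed.
Lemma cj_sum (R : realType) (I : Type) (r : seq I) (P : pred I) (F : I -> R[i]) :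
  cj (\sum_(i <- r | P i) F i) = \sum_(i <- r | P i) cj (F i).
Proof. exact: rmorph_sum. Qed.

(** * The Christoffel-Darboux kernel *)

Section ChristoffelDarboux.

(** When [q = z^n w^m conj(p)] on the torus, this is [z^n] times the coefficient of
    [conj(eta)^k] in the Christoffel-Darboux kernel
    [(p(w) conj(p(eta)) - q(w) conj(q(eta))) / (1 - w conj(eta))] of the weight
    [1 / |p|^2]; the quotient is expanded as a geometric series. *)
Definition cd_poly (A : comNzRingType) (m : nat) (p q : {poly A}) (k : nat) : {poly A} :=
  p * (\sum_(l < k.+1) (q`_(m - l))%:P * 'X^(k - l)) -
  q * (\sum_(l < k.+1) (p`_(m - l))%:P * 'X^(k - l)).

Lemma coef_cd_half (A : comNzRingType) (m k : nat) (p q : {poly A}) e :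
    (size p <= m.+1)%N -> (k < m)%N ->
  (p * (\sum_(l < k.+1) (q`_(m - l))%:P * 'X^(k - l)))`_(m + e)
  = if (e <= k)%N then \sum_(l < (k - e).+1) q`_(m - l) * p`_(m - (k - e - l)) else 0.
Proof.
move=> hp km; rewrite mulr_sumr coef_sum.
have h (l : nat) : (l < k.+1)%N -> (p * ((q`_(m - l))%:P * 'X^(k - l)))`_(m + e)
    = if (l < (k - e).+1)%N && (e <= k)%N then q`_(m - l) * p`_(m - (k - e - l)) else 0.
  move=> lk; rewrite mulrCA coefCM coefMXn ltnNge (leq_trans (leq_subr _ _))/=; last first.
    by rewrite (leq_trans (ltnW km))// leq_addr.
  case: ifP => [/andP[h1 h2]|h1]; first by congr (_ * p`__); lia.
  by rewrite (_ : p`_ _ = 0) ?mulr0// nth_default// (leq_trans hp)//; lia.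
case: ifP => [ek|ek].
  rewrite (big_ord_widen k.+1 (fun l => q`_(m - l) * p`_(m - (k - e - l))))//; last by lia.
  by rewrite [RHS]big_mkcond; apply: eq_bigr => l _; rewrite h// ek andbT.
by rewrite big1// => l _; rewrite h// ek andbF.
Qed.

(** The two halves of the Christoffel-Darboux numerator have the same
    coefficients from degree [m] on. *)
Lemma size_cd (A : comNzRingType) (m k : nat) (p q : {poly A}) :
    (size p <= m.+1)%N -> (size q <= m.+1)%N -> (k < m)%N ->
  (size (cd_poly m p q k) <= m)%N.
Proof.
move=> hp hq km; apply/leq_sizeP => j mj; rewrite -(subnKC mj) coefB.
rewrite !coef_cd_half//; case: ifP => _; last by rewrite subrr.
apply/eqP; rewrite subr_eq0; apply/eqP.
rewrite (reindex_inj rev_ord_inj)/=; apply: eq_bigr => l _.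
by rewrite subSS mulrC; congr (p`_(m - _) * _); move: (ltn_ord l); lia.
Qed.

Variable R : realType.
Implicit Types (f g : bipoly R).

Lemma size_coefM f g N N' : (forall t, (size (f`_t)%R <= N.+1)%N) ->
  (forall t, (size (g`_t)%R <= N'.+1)%N) ->
  forall t, (size ((f * g)`_t)%R <= (N + N').+1)%N.
Proof.
move=> hf hg t; rewrite coefM; apply: leq_trans (size_sum _ _ _) _.
apply/bigmax_leqP => i _; apply: leq_trans (size_polyMleq _ _) _.
by have := hf i; have := hg (t - i)%N; lia.
Qed.

Lemma size_coef_sumXn (K : nat) (c : nat -> {poly R[i]}) (d : nat -> nat) N :
    (forall l, (size (c l) <= N)%N) ->
  forall t, (size ((\sum_(l < K) (c l)%:P * 'X^(d l) : bipoly R)`_t)%R <= N)%N.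
Proof.
move=> hc t; rewrite coef_sum; apply: leq_trans (size_sum _ _ _) _.
apply/bigmax_leqP => i _; rewrite coefCM coefXn.
by case: eqP => _; rewrite ?mulr1 ?mulr0 ?size_poly0.
Qed.

Variables (n m : nat) (p : bipoly R).
Hypothesis hbox : box n.+1 m.+1 p.
Hypothesis hp : forall z w : R[i], `|z| = 1 -> `|w| <= 1 -> ev p z w != 0.
Local Notation TR := (measurableTypeR R).
Local Notation bm := (bmeas (@square R)).
Local Notation q := (refl n m p).
Local Notation D := (cd_poly m p q).

Lemma box_refl : box n.+1 m.+1 q.
Proof.
split=> [|t]; first exact: size_poly.
by rewrite coef_poly; case: ifP; rewrite ?size_poly0 ?size_poly.
Qed.

Lemma size_D k : (k < m)%N -> (size (D k) <= m)%N.
Proof. by move=> km; apply: size_cd => //; [exact: hbox.1|exact: box_refl.1]. Qed.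

Lemma size_coef_D k t : (size ((D k)`_t)%R <= (n + n).+1)%N.
Proof.
rewrite coefB (leq_trans (size_polyD _ _))// size_polyN geq_max; apply/andP; split.
  apply: size_coefM t; first exact: hbox.2.
  by apply: (@size_coef_sumXn k.+1 (fun l => (q)`_(m - l)) (fun l => (k - l)%N) n.+1) => l;
    exact: box_refl.2.
apply: size_coefM t; first exact: box_refl.2.
by apply: (@size_coef_sumXn k.+1 (fun l => (p)`_(m - l)) (fun l => (k - l)%N) n.+1) => l;
  exact: hbox.2.
Qed.

Definition weight (x : TR * TR) : R[i] := (evx p x * cj (evx p x))^-1.

Lemma bm_weight : bm weight.
Proof.
have e x : weight x = (evx p x)^-1 * cj ((evx p x)^-1).
  by rewrite /weight invfM conjc_inv.
apply: (bmeas_ext (f := fun x => (evx p x)^-1 * cj ((evx p x)^-1))) => [x|]; first by rewrite e.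
by apply: bmeasM; [|apply: bmeas_conj]; exact: bm_pinv hp.
Qed.

Lemma evx_head k x : (k < m)%N ->
  evx (\sum_(l < k.+1) (q`_(m - l))%:P * 'X^(k - l)) x
  = mono n%:Z k%:Z x * cj (evx (take_poly k.+1 p) x).
Proof.
move=> km.
have -> : take_poly k.+1 p = \sum_(l < k.+1) (p`_l)%:P * 'X^l.
  by rewrite /take_poly poly_def; apply: eq_bigr => l _; rewrite mul_polyC.
rewrite !evx_sum cj_sum mulr_sumr; apply: eq_bigr => l _.
have lm : (l <= m)%N by have := ltn_ord l; lia.
rewrite !evxM !evxXn cjM mono_conj.
have -> : (q`_(m - l))%:P = refl n 0 (p`_l)%:P.
  apply/polyP => -[|j]; last by rewrite [LHS]coefC [RHS]coef_poly.
  by rewrite coefC !coef_poly/= ltnS leq_subr subKn// subn0 coefC.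
rewrite evx_refl; last first.
  split=> [|t]; first exact: size_polyC_leq1.
  by rewrite coefC; case: eqP => _; [exact: hbox.2|rewrite size_poly0].
have -> : mono n k x = mono n 0 x * mono 0 (k - l)%N x * mono 0 l x.
  by rewrite !monoM; congr (mono _ _ _); have := ltn_ord l; lia.
have e : mono 0 l x * mono 0 (- l%:Z) x = 1 by rewrite monoM addr0 subrr mono0.
rewrite oppr0; set c := cj _.
transitivity (mono n 0 x * c * mono 0 (k - l)%N x * (mono 0 l x * mono 0 (- l%:Z) x)).
  by rewrite e mulr1.
by ring.
Qed.

(** The kernel property.  On the torus the half of [D k] divisible by [p]
    contributes [V conj(S) / p], where [S] is [z^n w^k] times the conjugate of the
    truncation of [p] at [w^k]; replacing the truncation by [p] minus its remainder
    gives the two terms on the right.  The half divisible by [q] contributes the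
    conjugate of [w f / p] for a polynomial [f], up to a power of [z], because the
    degree of [V] in [w] is less than [m + e]; this has mean zero. *)
Lemma cd_pairing (e : nat) (V : bipoly R) (i : int) k : (k < m)%N ->
    (size V <= m + e)%N ->
  mean (fun x => evx V x * cj (mono (i - n%:Z) e%:Z x * evx (D k) x) * weight x) =
  mean (fun x => evx V x * mono (- i) (- (k + e)%N%:Z) x) -
  mean (fun x => mono (- i) (1 - e%:Z) x * evx (V * drop_poly k.+1 p) x / evx p x).
Proof.
move=> km sV; have [N [_ [_ bV]]] := box_exists V.
pose M := (m + e).-1.
have MS : (m + e = M.+1)%N by rewrite /M; lia.
have {}bV : box N.+1 M.+1 V by split=> //; rewrite -MS.
pose S' := \sum_(l < k.+1) (p`_(m - l))%:P * 'X^(k - l).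
(* [A] and [B] are the two terms on the right, [C] is the conjugate of the half
   divisible by [q]. *)
pose A x := evx V x * mono (- i) (- (k + e)%N%:Z) x.
pose B x := mono (- i) (1 - e%:Z) x * evx (V * drop_poly k.+1 p) x / evx p x.
pose C x := mono (i - N%:Z) 1 x * evx (refl N M V * S') x / evx p x.
have bC : bm C by apply: bmeasM; [apply: bmeasM; [exact: bm_mono|exact: bm_evx]|exact: bm_pinv].
have bA : bm A by apply: bmeasM; [exact: bm_evx|exact: bm_mono].
have bB : bm B by apply: bmeasM; [apply: bmeasM; [exact: bm_mono|exact: bm_evx]|exact: bm_pinv].
transitivity (mean (fun x => (A x - B x) - cj (C x))); last first.
  rewrite meanB ?meanB ?mean_conj//; [|exact: bmeasB|exact: bmeas_conj].
  by rewrite {3}/mean -/(mean C) mean_over_p_shift// rmorph0 subr0.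
apply: eq_mean => x.
have P0 := evp_neq0 hp x; have P'0 : cj (evx p x) != 0 by rewrite conjc_eq0.
have eT : evx (take_poly k.+1 p) x = evx p x - mono 0 k.+1%:Z x * evx (drop_poly k.+1 p) x.
  have -> : evx p x = evx (take_poly k.+1 p) x + evx (drop_poly k.+1 p) x * mono 0 k.+1%:Z x.
    by rewrite -[in LHS](poly_take_drop k.+1 p) evxD evxM evxXn.
  by ring.
have eC : cj (C x) = evx V x * (mono (n%:Z - i) (- e%:Z) x * mono (- n%:Z) (- m%:Z) x)
    * cj (evx S' x) / cj (evx p x).
  rewrite /C evxM evx_refl// !cjM conjcK conjc_inv !mono_conj.
  have -> : mono (n%:Z - i) (- e%:Z) x * mono (- n%:Z) (- m%:Z) x
      = mono (- (i - N%:Z)) (- 1) x * mono (- N%:Z) (- M%:Z) x.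
    by rewrite !monoM; congr (mono _ _ _); lia.
  by ring.
rewrite eC /A /B evxM /weight invfM evxD evxN !evxM.
rewrite -/S' evx_head// evx_refl// !(cjM, cjB) !mono_conj !conjcK eT.
have -> : mono (- i) (- (k + e)%N%:Z) x
    = mono (n%:Z - i) (- e%:Z) x * mono (- n%:Z) (- k%:Z) x.
  by rewrite monoM; congr (mono _ _ _); lia.
have -> : mono (- i) (1 - e%:Z) x
    = mono (n%:Z - i) (- e%:Z) x * mono (- n%:Z) (- k%:Z) x * mono 0 k.+1%:Z x.
  by rewrite !monoM; congr (mono _ _ _); lia.
rewrite opprB; field; by rewrite P0 P'0.
Qed.

Lemma cd_pairing0 (V : bipoly R) (i k : nat) : (k < m)%N -> (size V <= m)%N ->
  mean (fun x => evx V x * cj (evx ('X^i%:P * D k) x) * weight x) = (V`_k)`_(i + n).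
Proof.
move=> km sV; have := @cd_pairing 0 V (i + n)%N%:Z k km.
rewrite !addn0 => /(_ sV); rewrite subr0 mean_over_p_shift// subr0 mean_coef => <-.
apply: eq_mean => x; rewrite evxM evxZn; congr (_ * cj (mono _ _ _ * _) * _); lia.
Qed.

Lemma cd_pairing1 (V : bipoly R) (i : int) k : (k < m)%N -> (size V <= m.+1)%N ->
  mean (fun x => evx V x * cj (mono (i - n%:Z) 1 x * evx (D k) x) * weight x) =
  mean (fun x => evx V x * mono (- i) (- k.+1%:Z) x) -
  mean (fun x => mono (- i) 0 x * evx (V`_0 * p`_k.+1)%:P x / evx p x).
Proof.
move=> km sV; rewrite (@cd_pairing 1 V i k km) ?addn1//; congr (_ - _).
rewrite (_ : 1 - _ = 0 :> int)// (mean_over_p_const hp (V * drop_poly k.+1 p)).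
by rewrite coef0M coef_drop_poly.
Qed.

End ChristoffelDarboux.

(** * Banded systems and the weighted pairing *)

Section BandedKernel.
Variables (R : realType) (n m : nat).

Lemma sum_shift (V : zmodType) (K : nat -> V) lo M : (forall a, (a < lo)%N -> K a = 0) ->
  \sum_(d < M) K (lo + d)%N = \sum_(a < lo + M) K a.
Proof. by move=> h; rewrite big_split_ord/= [X in X + _]big1 ?add0r// => a _; exact: h. Qed.

Definition band (u : nat -> 'I_m -> 'I_m -> R[i]) (d : int) k j : R[i] :=
  if (`|d| <= n)%N then u (absz (d + n%:Z)) k j else 0.

Lemma toeplitz_form_rev (g : int -> 'I_m -> 'I_m -> R[i]) N v :
  toeplitz_form (fun d => g (- d)) N v
  = toeplitz_form g N (fun i => v (N - i.+1)%N).
Proof.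
rewrite /toeplitz_form (reindex_inj rev_ord_inj)/=; apply: eq_bigr => i _.
rewrite (reindex_inj rev_ord_inj)/=; apply: eq_bigr => i' _.
apply: eq_bigr => k _; apply: eq_bigr => j _; congr (_ * g _ k j).
by have := ltn_ord i; have := ltn_ord i'; lia.
Qed.

Lemma band_rev u d k j : band (fun d => u (n + n - d)%N) d k j = band u (- d) k j.
Proof.
rewrite /band; have -> : `|(- d)%R|%N = `|d|%N by lia.
by case: leqP => // h; congr (u _ k j); lia.
Qed.

(** Dropping the first [n] unknowns, which are zero, turns the system with the
    coefficients [u] into a one-sided Toeplitz system. *)
Lemma banded_kernel_eq0 (u : nat -> 'I_m -> 'I_m -> R[i]) (c B : R) (y : nat -> 'I_m -> R[i]) :
    0 < c ->
    (forall N (v : nat -> 'I_m -> R[i]),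
      c * \sum_(i < N) \sum_k nc (v i k) ^+ 2 <= complex.Re (toeplitz_form (band u) N v)) ->
    (forall a j, nc (y a j) <= B) ->
    (forall a j, (a < n)%N -> y a j = 0) ->
    (forall i k, \sum_(d < (n + n).+1) \sum_j cj (u d k j) * y (i + d)%N j = 0) ->
  forall a j, y a j = 0.
Proof.
move=> c0 hc hB hy hu a j; have [/hy//|na] := ltnP a n.
rewrite -(subnKC na).
have hband d k j' : (n < `|d|)%N -> band u d k j' = 0 by rewrite /band ltnNge => /negbTE ->.
apply: (@toeplitz_bounded_kernel R n m (band u) hband c c0 hc
  (fun i => y (n + i)%N) B) => // i k.
pose K a := \sum_j cj (band u (a%:Z - n%:Z - i%:Z) k j) * y a j.
transitivity (\sum_(i' < (i + n).+1) K (n + i')%N).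
  apply: eq_bigr => i' _; apply: eq_bigr => j' _.
  by congr (cj (band u _ k j') * _); lia.
rewrite (@sum_shift _ K); last first.
  by move=> b bn; apply: big1 => j' _; rewrite hy ?mulr0.
have -> : (n + (i + n).+1 = i + (n + n).+1)%N by lia.
rewrite -(@sum_shift _ K); last first.
  move=> b bi; rewrite /K; have [/hy h|nb] := ltnP b n.
    by apply: big1 => j' _; rewrite h mulr0.
  by apply: big1 => j' _; rewrite hband ?conjc0 ?mul0r//; lia.
rewrite -[RHS](hu i k); apply: eq_bigr => d _; apply: eq_bigr => j' _.
rewrite /band; have -> : (`|((i + d)%N%:Z - n%:Z - i%:Z)%R| <= n)%N.
  by have := ltn_ord d; lia.
by congr (cj (u _ k j') * _); lia.
Qed.

End BandedKernel.

Section Pairing.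
Variable R : realType.
Implicit Types (f g h : bipoly R).
Variables (p : bipoly R).
Hypothesis hp : forall z w : R[i], `|z| = 1 -> `|w| <= 1 -> ev p z w != 0.
Local Notation TR := (measurableTypeR R).
Local Notation bm := (bmeas (@square R)).

Definition ipw f g : R[i] := mean (fun x => evx f x * cj (evx g x) * weight p x).

Lemma bm_ipw f g : bm (fun x => evx f x * cj (evx g x) * weight p x).
Proof.
apply: bmeasM; last exact: bm_weight hp.
by apply: bmeasM; [|apply: bmeas_conj]; exact: bm_evx.
Qed.

Lemma ipwDl f g h : ipw (f + g) h = ipw f h + ipw g h.
Proof.
rewrite /ipw -meanD; [|exact: bm_ipw..].
by apply: eq_mean => x; rewrite evxD; ring.
Qed.

Lemma ipwZl (c : R[i]) f g : ipw (c%:P%:P * f) g = c * ipw f g.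
Proof.
rewrite /ipw -meanZ; last exact: bm_ipw.
by apply: eq_mean => x; rewrite evxM evxC; ring.
Qed.

Lemma ipwC f g : ipw g f = cj (ipw f g).
Proof.
rewrite /ipw -mean_conj; last exact: bm_ipw.
apply: eq_mean => x; rewrite !cjM conjcK /weight conjc_inv cjM conjcK.
by rewrite [cj (evx p x) * _]mulrC; ring.
Qed.

Lemma ipw0l g : ipw 0 g = 0.
Proof. by have := ipwZl 0 0 g; rewrite mulr0 mul0r. Qed.

Lemma ipw0r g : ipw g 0 = 0.
Proof. by rewrite ipwC ipw0l conjc0. Qed.

Lemma ipwDr f g h : ipw h (f + g) = ipw h f + ipw h g.
Proof. by rewrite ipwC ipwDl cjD -!ipwC. Qed.

Lemma ipwZr (c : R[i]) f g : ipw g (c%:P%:P * f) = cj c * ipw g f.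
Proof. by rewrite ipwC ipwZl cjM -ipwC. Qed.

Lemma ipw_sumr (I : Type) (r : seq I) (P : pred I) (F : I -> bipoly R) g :
  ipw g (\sum_(i <- r | P i) F i) = \sum_(i <- r | P i) ipw g (F i).
Proof.
by elim/big_rec2: _ => [|i x y _ <-]; [exact: ipw0r|rewrite ipwDr].
Qed.

Lemma weight_ge0 x : 0 <= weight p x.
Proof. by rewrite invr_ge0 mulcJ_ge0. Qed.

Lemma ipw_ge0 f : 0 <= ipw f f.
Proof. by apply: mean_ge0 => x _; rewrite mulr_ge0 ?weight_ge0// mulcJ_ge0. Qed.

Lemma mulcJE (z : R[i]) : z * cj z = (nc z ^+ 2)%:C.
Proof. by rewrite -sqr_normc rmorphXn. Qed.

(** The weight is at most the inverse square of the lower bound for [p]. *)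
Lemma ipw_upper : exists2 C : R, 0 < C & forall f,
  complex.Re (ipw f f) <= C * complex.Re (mean (fun x => evx f x * cj (evx f x))).
Proof.
have [|e e0 he] := @torus_lower_bound R p; first by move=> s t; rewrite hp// normr_circ.
exists (e ^- 2) => [|f]; first by rewrite invr_gt0 exprn_gt0.
have bff : bm (fun x => evx f x * cj (evx f x)).
  by apply: bmeasM; [|apply: bmeas_conj]; exact: bm_evx.
have : 0 <= (e ^- 2)%:C * mean (fun x => evx f x * cj (evx f x)) - ipw f f.
  rewrite -meanZ// -meanB; [|by apply: bmeasM => //; exact: bmeas_cst|exact: bm_ipw].
  apply: mean_ge0 => x sx; rewrite [X in X - _]mulrC -mulrBr mulr_ge0 ?mulcJ_ge0//.
  rewrite subr_ge0 /weight mulcJE -fmorphV lecR lef_pV2 ?posrE ?exprn_gt0//.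
    by rewrite lerXn2r ?nnegrE ?nc_ge0 ?(ltW e0)// he.
  exact: lt_le_trans (he x sx).
rewrite lecE => /andP[_]; move: (mean _) (ipw _ _) => [a b] [c d] /=.
by rewrite mul0r subr0 subr_ge0.
Qed.

End Pairing.

(** * Moments of a polynomial *)

Section Moments.
Variables (R : realType) (n m : nat) (p : bipoly R).
Hypothesis hbox : box n.+1 m.+1 p.
Hypothesis hp : forall z w : R[i], `|z| = 1 -> `|w| <= 1 -> ev p z w != 0.
Local Notation TR := (measurableTypeR R).
Local Notation bm := (bmeas (@square R)).
Local Notation q := (refl n m p).
Local Notation D := (cd_poly m p q).
Local Notation weight := (weight p).
Implicit Types (f g F : bipoly R).

Definition cdcoef (d : nat) (k j : 'I_m) : R[i] := ((D k)`_j)`_d.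

Lemma size_mulC (c : {poly R[i]}) f M : (size f <= M)%N -> (size (c%:P * f)%R <= M)%N.
Proof. by apply: leq_trans; rewrite mul_polyC size_scale_leq. Qed.

Lemma size_sum_le (I : Type) (r : seq I) (G : I -> bipoly R) M :
  (forall i, (size (G i) <= M)%N) -> (size (\sum_(i <- r) G i)%R <= M)%N.
Proof.
move=> h; elim/big_rec: _ => [|i f _ hf]; first by rewrite size_poly0.
by rewrite (leq_trans (size_polyD _ _))// geq_max h.
Qed.

(** With [U] the polynomial of coefficients [v], shifted by [z^n], and [V] its
    image under the kernel, [<V, V>] is the Toeplitz form and [<U, V>] is the sum of
    squares [s], while [<U, U> <= C s].  The claim follows from
    [0 <= <V - t U, V - t U>] for [t = C^-1], the optimal choice. *)
Lemma cd_coercive : exists2 c : R, 0 < c & forall N (v : nat -> 'I_m -> R[i]),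
  c * \sum_(i < N) \sum_k nc (v i k) ^+ 2
  <= complex.Re (toeplitz_form (band n cdcoef) N v).
Proof.
have [C C0 hC] := ipw_upper hp.
exists C^-1 => [|N v]; first by rewrite invr_gt0.
pose V : bipoly R := \sum_(i < N) \sum_(k < m) (v i k)%:P%:P * ('X^i%:P * D k).
pose U : bipoly R := \sum_(i < N) \sum_(k < m) (v i k)%:P%:P * ('X^(i + n)%:P * 'X^k).
have sV : (size V <= m)%N.
  by do 2! (apply: size_sum_le => ?); do 2! apply: size_mulC; exact: size_D.
have sU : (size U <= m)%N.
  by do 2! (apply: size_sum_le => ?); do 2! apply: size_mulC; rewrite size_polyXn.
have pairV (W : bipoly R) : (size W <= m)%N ->
    ipw p W V = \sum_(i < N) \sum_(k < m) cj (v i k) * (W`_k)`_(i + n).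
  move=> sW; rewrite ipw_sumr//; apply: eq_bigr => i _.
  rewrite ipw_sumr//; apply: eq_bigr => k _; rewrite ipwZr//; congr (_ * _).
  exact: cd_pairing0.
have coefV (i' : nat) (j : 'I_m) : (V`_j)`_(i' + n)
    = \sum_(i < N) \sum_(k < m) v i k * band n cdcoef (i'%:Z - i%:Z) k j.
  rewrite !coef_sum; apply: eq_bigr => i _; rewrite !coef_sum; apply: eq_bigr => k _.
  rewrite !coefCM coefXnM /band; case: (leqP `|(i'%:Z - i%:Z)%R|%N n) => h.
    rewrite ifF; last by apply/negbTE; lia.
    by rewrite /cdcoef; congr (_ * ((D k)`_j)`__); lia.
  case: ifP => // h2; congr (_ * _); rewrite nth_default//.
  by rewrite (leq_trans (size_coef_D hbox k j))//; lia.
have coefU (i : 'I_N) (k : 'I_m) : (U`_k)`_(i + n) = v i k.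
  rewrite !coef_sum (bigD1 i)//= [X in _ + X]big1 ?addr0; last first.
    move=> i' ii'; rewrite !coef_sum big1// => k' _.
    rewrite !coefCM coefXnM coefXn; case: ifP => h; rewrite ?mulr0//.
    rewrite coefMn coef1 (_ : _ == 0%N = false) ?mul0rn ?mulr0//; apply/negbTE.
    move/negbTE: ii' => /eqP ii'; apply/negP => /eqP e; apply: ii'.
    by apply: val_inj => /=; lia.
  rewrite !coef_sum (bigD1 k)//= [X in _ + X]big1 ?addr0; last first.
    move=> k' kk'; rewrite !coefCM coefXnM coefXn; case: ifP => h; rewrite ?mulr0//.
    by rewrite eq_sym (inj_eq val_inj) (negbTE kk') coef0 mulr0.
  by rewrite !coefCM coefXnM ltnn subnn coefXn eqxx coef1 eqxx mulr1.
pose s := \sum_(i < N) \sum_k nc (v i k) ^+ 2.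
have pUV : ipw p U V = s%:C.
  rewrite pairV// rmorph_sum; apply: eq_bigr => i _; rewrite rmorph_sum.
  by apply: eq_bigr => k _; rewrite coefU mulrC mulcJE.
have pVV : ipw p V V = toeplitz_form (band n cdcoef) N v.
  rewrite pairV// /toeplitz_form [RHS]exchange_big/=; apply: eq_bigr => i' _.
  transitivity (\sum_(j < m) \sum_(i < N) \sum_(k < m)
      v i k * cj (v i' j) * band n cdcoef (i'%:Z - i%:Z) k j).
    apply: eq_bigr => j _; rewrite coefV mulr_sumr; apply: eq_bigr => i _.
    by rewrite mulr_sumr; apply: eq_bigr => k _; ring.
  rewrite exchange_big/=; apply: eq_bigr => i _.
  by rewrite exchange_big.
have mUU : mean (fun x => evx U x * cj (evx U x)) = s%:C.
  transitivity (\sum_(i < N) \sum_(k < m)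
      cj (v i k) * mean (fun x => evx U x * mono (- (i + n)%N%:Z) (- k%:Z) x)).
    have b i k : bm (fun x => evx U x * mono i k x).
      by apply: bmeasM; [exact: bm_evx|exact: bm_mono].
    have b2 (c : R[i]) i k : bm (fun x => c * (evx U x * mono i k x)).
      by apply: bmeasM => //; exact: bmeas_cst.
    under [RHS]eq_bigr do under eq_bigr do rewrite -meanZ//.
    under [RHS]eq_bigr do rewrite -mean_sum//.
    rewrite -mean_sum//; last by move=> i _; apply: bmeas_sum.
    apply: eq_mean => x; rewrite {2}/U evx_sum cj_sum mulr_sumr; apply: eq_bigr => i _.
    rewrite evx_sum cj_sum mulr_sumr; apply: eq_bigr => k _.
    rewrite !evxM evxC evxZn evxXn monoM addr0 add0r cjM mono_conj; ring.
  rewrite rmorph_sum; apply: eq_bigr => i _; rewrite rmorph_sum; apply: eq_bigr => k _.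
  by rewrite mean_coef coefU mulrC mulcJE.
have t0 : 0 < C^-1 by rewrite invr_gt0.
have := ipw_ge0 p (V + (- C^-1)%:C%:P%:P * U).
rewrite ipwDl// !ipwDr// !ipwZl// !ipwZr// conjc_real (ipwC hp U V) pUV conjc_real pVV.
rewrite lecE => /andP[_]; have := hC U; rewrite mUU -/s.
move: (ipw p U U) (toeplitz_form _ _ _) => [a b] [c d] /=.
rewrite !(mul0r, mulr0, subr0, addr0) => h1 h2.
have h3 : C^-1 * (C^-1 * a) <= C^-1 * s.
  by rewrite ler_wpM2l ?(ltW t0)// ler_pdivrMl.
nra.
Qed.

Definition moment F (i : int) (j : nat) : R[i] :=
  mean (fun x => evx F x * cj (mono i j%:Z x) * weight x).

Lemma bm_moment F i j : bm (fun x => evx F x * cj (mono i j x) * weight x).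
Proof.
apply: bmeasM; last exact: bm_weight hp.
by apply: bmeasM; [exact: bm_evx|apply: bmeas_conj; exact: bm_mono].
Qed.

Lemma moment_bounded F : exists B, forall i j, nc (moment F i j) <= B.
Proof.
have [M1 hM1] : exists M, forall x, square (R := R) x -> nc (evx F x) <= M.
  by have [_ _ [M h]] := bm_evx F; exists M.
have [M2 hM2] : exists M, forall x, square (R := R) x -> nc (weight x) <= M.
  by have [_ _ [M h]] := bm_weight hp; exists M.
have [B hB] := mean_bounded (M1 * M2).
exists B => i j; apply: hB => [|x sx]; first exact: bm_moment.
by rewrite !Normc.normcM nc_conj nc_mono mulr1 ler_pM ?nc_ge0 ?hM1 ?hM2.
Qed.

Lemma cd_moment F (i : int) (k : 'I_m) :
  mean (fun x => evx F x * cj (mono i 1 x * evx (D k) x) * weight x) =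
  \sum_(d < (n + n).+1) \sum_j cj (cdcoef d k j) * moment F (i + d%:Z) j.+1.
Proof.
have bD : box (n + n).+1 m (D k).
  by split=> [|t]; [exact: (size_D hbox)|exact: (size_coef_D hbox)].
have b2 (c : R[i]) i' j' : bm (fun x => c * (evx F x * cj (mono i' j' x) * weight x)).
  by apply: bmeasM; [exact: bmeas_cst|exact: bm_moment].
rewrite exchange_big/=.
under [RHS]eq_bigr do under eq_bigr do rewrite -(meanZ _ (bm_moment _ _ _)).
under [RHS]eq_bigr do rewrite -mean_sum//.
rewrite -mean_sum//; last by move=> j _; apply: bmeas_sum.
apply: eq_mean => x; rewrite (evx_box _ bD) mulr_sumr cj_sum mulr_sumr mulr_suml.
apply: eq_bigr => j _; rewrite mulr_sumr cj_sum mulr_sumr mulr_suml.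
apply: eq_bigr => d _; rewrite mulrCA monoM cjM -[j.+1]add1n PoszD; ring.
Qed.

(** By [cd_pairing1], the last hypothesis says that the moments with exponent at
    least [n] in [z] solve the homogeneous Toeplitz system of the kernel. *)
Lemma moment_right F : (size F <= m.+1)%N ->
    (forall i j, (i < n)%N -> (j < m)%N -> moment F i%:Z j.+1 = 0) ->
    (forall i k : nat, (k < m)%N ->
      mean (fun x => evx F x * mono (- (i + n)%N%:Z) (- k.+1%:Z) x) =
      mean (fun x => mono (- (i + n)%N%:Z) 0 x * evx (F`_0 * p`_k.+1)%:P x / evx p x)) ->
  forall a j : nat, (j < m)%N -> moment F a%:Z j.+1 = 0.
Proof.
move=> sF hy hk a j jm; have [c c0 hc] := cd_coercive.
have [B hB] := moment_bounded F.
apply: (@banded_kernel_eq0 R n m cdcoef c B (fun a j => moment F a%:Z j.+1)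
  c0 hc _ _ _ a (Ordinal jm)) => //.
- by move=> b j' bn; exact: hy.
- move=> i k; transitivity
      (\sum_(d < (n + n).+1) \sum_j cj (cdcoef d k j) * moment F (i%:Z + d%:Z) j.+1).
    by [].
  rewrite -cd_moment; have -> : i%:Z = (i + n)%N%:Z - n%:Z by lia.
  by rewrite (cd_pairing1 hbox hp)// hk// subrr.
Qed.

(** The same with the moments of negative exponent, read backwards: this reverses
    the band, and [toeplitz_form_rev] shows that coercivity is preserved. *)
Lemma moment_left F : (size F <= m.+1)%N ->
    (forall i j, (i < n)%N -> (j < m)%N -> moment F i%:Z j.+1 = 0) ->
    (forall i k : nat, (k < m)%N ->
      mean (fun x => evx F x * mono i.+1%:Z (- k.+1%:Z) x) =
      mean (fun x => mono i.+1%:Z 0 x * evx (F`_0 * p`_k.+1)%:P x / evx p x)) ->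
  forall a j : nat, (j < m)%N -> moment F (n%:Z - 1 - a%:Z) j.+1 = 0.
Proof.
move=> sF hy hk a j jm; have [c c0 hc] := cd_coercive.
have [B hB] := moment_bounded F.
apply: (@banded_kernel_eq0 R n m (fun d => cdcoef (n + n - d)%N) c B
  (fun a j => moment F (n%:Z - 1 - a%:Z) j.+1) c0 _ _ _ _ a (Ordinal jm)) => //.
- move=> N v; pose v' i := v (N - i.+1)%N.
  have -> : toeplitz_form (band n (fun d => cdcoef (n + n - d)%N)) N v
      = toeplitz_form (band n cdcoef) N v'.
    rewrite -toeplitz_form_rev /toeplitz_form; do 4! (apply: eq_bigr => ? _).
    by rewrite band_rev.
  rewrite (reindex_inj rev_ord_inj)/=; exact: hc.
- move=> b j' bn; have -> : n%:Z - 1 - b%:Z = (n - b.+1)%N%:Z by lia.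
  by apply: hy => //; lia.
- move=> i k; transitivity
      (\sum_(d < (n + n).+1) \sum_j cj (cdcoef d k j) * moment F ((- i.+1%:Z - n%:Z) + d%:Z) j.+1).
    rewrite (reindex_inj rev_ord_inj)/=; apply: eq_bigr => d _; apply: eq_bigr => j' _.
    by rewrite subSS; congr (cj (cdcoef _ k j') * moment F _ _); have := ltn_ord d; lia.
  by rewrite -cd_moment (cd_pairing1 hbox hp)// opprK hk// subrr.
Qed.

End Moments.

(** * The two factors of p(z, 0) *)

Section SplitFactors.
Variables (R : realType) (n m : nat) (p : bipoly R).
Hypothesis hbox : box n.+1 m.+1 p.
Hypothesis hp : forall z w : R[i], `|z| = 1 -> `|w| <= 1 -> ev p z w != 0.
Variables (a b : {poly R[i]}).
Hypothesis hab : p`_0 = a * b.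
Hypothesis ha : forall z : R[i], `|z| <= 1 -> a.[z] != 0.
Hypothesis hb : forall z : R[i], b.[z] = 0 -> `|z| < 1.
Local Notation TR := (measurableTypeR R).
Local Notation bm := (bmeas (@square R)).
Local Notation weight := (weight p).
Implicit Types (f g h F G : bipoly R) (r s : {poly R[i]}).

(** This is the Fourier coefficient of exponent [- i] of [r / p(z, 0)], since the
    mean of [1 / p(z, .)] over the circle is [1 / p(z, 0)]. *)
Definition qcoef r (i : int) : R[i] := mean (fun x => mono i 0 x * evx r%:P x / evx p x).

Lemma bm_qcoef f i j : bm (fun x => mono i j x * evx f x / evx p x).
Proof.
by apply: bmeasM; [apply: bmeasM; [exact: bm_mono|exact: bm_evx]|exact: bm_pinv hp].
Qed.

Lemma qcoefM r s i : qcoef (r * s) i = \sum_(l < size s) s`_l * qcoef r (i + l%:Z).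
Proof.
have b2 (c : R[i]) i' : bm (fun x => c * (mono i' 0 x * evx r%:P x / evx p x)).
  by apply: bmeasM; [exact: bmeas_cst|exact: bm_qcoef].
under eq_bigr do rewrite -(meanZ _ (bm_qcoef _ _ _)).
rewrite -mean_sum//; apply: eq_mean => x.
rewrite polyCM evxM [X in _ * (_ * X)](_ : _ = \sum_(l < size s) s`_l * mono l%:Z 0 x).
  rewrite mulr_sumr mulr_sumr mulr_suml; apply: eq_bigr => l _.
  have -> : mono (i + l%:Z) 0 x = mono i 0 x * mono l%:Z 0 x by rewrite monoM addr0.
  by ring.
rewrite /evx evC horner_coef; apply: eq_bigr => l _.
by rewrite monoE expr0z mulr1.
Qed.

Lemma qcoef_bounded r : exists B, forall i, nc (qcoef r i) <= B.
Proof.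
have [_ _ [M hM]] : bm (fun x => evx r%:P x / evx p x).
  by apply: bmeasM; [exact: bm_evx|exact: bm_pinv hp].
have [B hB] := mean_bounded M.
exists B => i; apply: hB => [|x sx]; first exact: bm_qcoef.
by rewrite -mulrA Normc.normcM nc_mono mul1r hM.
Qed.

Lemma qcoef_ab i : i != 0 -> qcoef (a * b) i = 0.
Proof.
move=> i0; rewrite /qcoef -hab -(mean_over_p_const hp).
transitivity (mean (@mono R i 0)); last by rewrite mean_mono (negbTE i0).
by apply: eq_mean => x; rewrite mulfK// evp_neq0.
Qed.

(** Here [b / (a b) = 1 / a] is analytic in the disk. *)
Lemma qcoef_b_pos r (k : nat) : qcoef (b * r) k.+1%:Z = 0.
Proof.
have [B hB] := qcoef_bounded b.
have h : forall k, qcoef b k.+1%:Z = 0.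
  apply: (@bounded_recurrence_eq0 R a (fun k => qcoef b k.+1%:Z) B) => // j.
  rewrite -[RHS](@qcoef_ab j.+1%:Z)// mulrC qcoefM.
  by apply: eq_bigr => l _.
by rewrite qcoefM big1// => l _; rewrite (h (k + l)%N) mulr0.
Qed.

Lemma b_neq0 : b != 0.
Proof.
apply/negP => /eqP b0; have := hb (z := 1); rewrite b0 horner0 => /(_ erefl).
by rewrite normr1 ltxx.
Qed.

Lemma a_neq0 : a != 0.
Proof. by apply: contraTneq (ha (z := 0) _) => [->|]; rewrite ?horner0 ?eqxx ?normr0. Qed.

Lemma size_ab : (size a + size b <= n.+2)%N.
Proof.
have : (size (p`_0)%R <= n.+1)%N by exact: hbox.2.
by rewrite hab size_mul ?a_neq0 ?b_neq0//; case: (_ + _)%N.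
Qed.

Lemma degp_lt r (d : nat) : deg_lt r d%:Z <-> (size r <= d)%N.
Proof.
rewrite /deg_lt /degp; split=> [[->|]|h]; first by rewrite size_poly0.
  by lia.
by have [->|r0] := eqVneq r 0; [left|right; move: r0; rewrite -size_poly_gt0; lia].
Qed.

(** Here [a / (a b) = 1 / b] is analytic outside the disk and vanishes to order
    [deg b] at infinity; read backwards, its coefficients satisfy the recurrence of
    the reversed polynomial of [b], which has no zeros in the closed disk. *)
Lemma qcoef_a_small (j : int) : j < (size b).-1%:Z -> qcoef a j = 0.
Proof.
move=> jb; pose d := (size b).-1; pose c := \poly_(l < d.+1) b`_(d - l).
have sb : size b = d.+1 by rewrite prednK// size_poly_gt0 b_neq0.
have hc (z : R[i]) : `|z| <= 1 -> c.[z] != 0.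
  move=> z1; have [->|z0] := eqVneq z 0.
    by rewrite horner_coef0 coef_poly/= subn0 -lead_coefE lead_coef_eq0 b_neq0.
  have -> : c.[z] = z ^+ d * b.[z^-1].
    rewrite horner_poly horner_coef sb mulr_sumr (reindex_inj rev_ord_inj)/=.
    apply: eq_bigr => l _; have ld : (l <= d)%N by rewrite -ltnS.
    have -> : z ^+ d = z ^+ (d - l) * z ^+ l by rewrite -exprD subnK.
    by rewrite subSS subKn// exprVn; field; rewrite expf_neq0.
  rewrite mulf_neq0 ?expf_neq0//; apply/eqP => /hb.
  by rewrite normfV invf_lt1 ?normr_gt0// => /lt_le_trans/(_ z1); rewrite ltxx.
have [B hB] := qcoef_bounded a.
have h : forall k : nat, qcoef a (d%:Z - 1 - k%:Z) = 0.
  apply: (@bounded_recurrence_eq0 R c (fun k => qcoef a (d%:Z - 1 - k%:Z)) B) => // k.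
  rewrite (recur_widen _ _ (size_poly _ _)) -[RHS](@qcoef_ab (- k.+1%:Z))//.
  rewrite qcoefM sb (reindex_inj rev_ord_inj)/=; apply: eq_bigr => l _.
  have ld : (l <= d)%N by rewrite -ltnS.
  by rewrite coef_poly subSS ltnS leq_subr subKn//; congr (_ * qcoef a _); lia.
have -> : j = d%:Z - 1 - `|(d%:Z - 1 - j)%R|%N%:Z by move: jb; rewrite -/d; lia.
exact: h.
Qed.

Lemma qcoef_ga r (i : int) : (size r <= (size b).-1)%N -> i <= 0 -> qcoef (r * a) i = 0.
Proof.
move=> sr i0; rewrite mulrC qcoefM big1// => l _.
by rewrite qcoef_a_small ?mulr0//; have := ltn_ord l; lia.
Qed.

Local Notation moment := (moment p).

(** Since [F(z, 0) / p(z, 0) = r / b] has only negative Fourier coefficients,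
    multiplying it by a polynomial of degree at most [n] leaves those of exponent at
    least [n] equal to zero. *)
Lemma split_right F r : box n m.+1 F -> F`_0 = r * a -> (size r <= (size b).-1)%N ->
    (forall i j, (i < n)%N -> (j < m)%N -> moment F i%:Z j.+1 = 0) ->
  forall i j : nat, (j < m)%N -> moment F i%:Z j.+1 = 0.
Proof.
move=> [F1 F2] F0 sr hF; apply: (moment_right hbox hp) => // i k km.
rewrite (mean_coef F (i + n) k.+1) nth_default; last first.
  by rewrite (leq_trans (F2 _))// leq_addl.
rewrite F0 -/(qcoef _ _) qcoefM big1// => l _.
rewrite qcoef_ga ?mulr0//; have := leq_trans (ltn_ord l) (hbox.2 k.+1); lia.
Qed.

(** Here [G(z, 0) / p(z, 0) = r / a] has only nonnegative Fourier coefficients. *)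
Lemma split_left G r : box n m.+1 G -> G`_0 = r * b ->
    (forall i j, (i < n)%N -> (j < m)%N -> moment G i%:Z j.+1 = 0) ->
  forall (i : int) (j : nat), i < n%:Z -> (j < m)%N -> moment G i j.+1 = 0.
Proof.
move=> [G1 G2] G0 hG i j ni jm.
have -> : i = n%:Z - 1 - `|(n%:Z - 1 - i)%R|%N%:Z by lia.
apply: (moment_left hbox hp) => // i' k km.
rewrite mean_coef_out// G0 -/(qcoef _ _).
by rewrite mulrAC [r * _ * b]mulrC qcoef_b_pos.
Qed.

Lemma ipw_wmul_eq0 F N M h : box N M h ->
  (forall i j, (i < N)%N -> (j < M)%N -> moment F i%:Z j.+1 = 0) -> ipw p F ('X * h) = 0.
Proof.
move=> bh hF.
have b2 (c : R[i]) i j : bm (fun x => c * (evx F x * cj (mono i j x) * weight x)).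
  by apply: bmeasM; [exact: bmeas_cst|exact: bm_moment].
transitivity (\sum_(t < M) \sum_(s < N) cj ((h`_t)`_s) * moment F s%:Z t.+1).
  under [RHS]eq_bigr do under eq_bigr do rewrite -(meanZ _ (bm_moment hp _ _ _)).
  under [RHS]eq_bigr do rewrite -mean_sum//.
  rewrite -mean_sum//; last by move=> t _; apply: bmeas_sum.
  apply: eq_mean => x; rewrite evxM (evx_box _ bh) mulr_sumr cj_sum mulr_sumr mulr_suml.
  apply: eq_bigr => t _; rewrite mulr_sumr cj_sum mulr_sumr mulr_suml.
  apply: eq_bigr => s _; rewrite -['X]expr1 evxXn mulrCA monoM cjM add0r.
  by rewrite -[t.+1]add1n PoszD; ring.
by rewrite big1// => t _; rewrite big1// => s _; rewrite hF ?mulr0.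
Qed.

Lemma ipw_bounded F G : exists B, forall k : nat, nc (ipw p F ('X^k%:P * G)) <= B.
Proof.
have [_ _ [M hM]] := bm_ipw hp F G.
have [B hB] := mean_bounded M.
exists B => k; apply: hB => [|x sx]; first exact: bm_ipw.
rewrite evxM evxZn cjM mulrCA -mulrA Normc.normcM nc_conj nc_mono mul1r hM//.
Qed.

(** With [a G = s p + w Q], the function [F] is orthogonal to [z^k s p] because
    [r / b] has only negative Fourier coefficients, and to [z^k w Q] because its
    moments vanish; the factor [a] is removed by [bounded_recurrence_eq0]. *)
Lemma split_orth F G r s : box n m.+1 F -> box n m.+1 G ->
    F`_0 = r * a -> (size r <= (size b).-1)%N -> G`_0 = s * b ->
    (forall i j : nat, (j < m)%N -> moment F i%:Z j.+1 = 0) ->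
  forall k : nat, ipw p F ('X^k%:P * G) = 0.
Proof.
move=> bF bG F0 sr G0 hF.
have [B hB] := ipw_bounded F G.
pose c := map_poly cj a.
have hc (z : R[i]) : `|z| <= 1 -> c.[z] != 0.
  move=> z1; rewrite /c -(conjcK z) horner_map conjc_eq0 ha//.
  by rewrite normcJ.
apply: (@bounded_recurrence_eq0 R c (fun k => ipw p F ('X^k%:P * G)) B) => // k.
transitivity (ipw p F ('X^k%:P * (a%:P * G))).
  have -> : 'X^k%:P * (a%:P * G)
      = \sum_(l < size c) (a`_l)%:P%:P * ('X^(k + l)%:P * G) :> bipoly R.
    rewrite size_map_poly_id0 ?conjc_eq0 ?lead_coef_eq0 ?a_neq0//.
    rewrite -[a in LHS]coefK poly_def rmorph_sum/= mulr_suml mulr_sumr.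
    apply: eq_bigr => l _; rewrite -mul_polyC !polyCM exprD polyCM; ring.
  rewrite ipw_sumr//; apply: eq_bigr => l _.
  by rewrite ipwZr// coef_map.
pose Q := drop_poly 1 (a%:P * G - s%:P * p).
have eQ : a%:P * G = s%:P * p + 'X * Q.
  apply/eqP; rewrite addrC -subr_eq; apply/eqP/divX_of_coef0.
  by rewrite coefB !coefCM G0 hab; ring.
have [N [_ [_ bQ]]] := box_exists ('X^k%:P * Q).
rewrite eQ mulrDr ipwDr// [X in _ + X](_ : _ = 0) ?addr0; last first.
  rewrite mulrCA; apply: (@ipw_wmul_eq0 F N.+1 m); last by move=> i j _; exact: hF.
  split=> //; rewrite size_mulC// size_drop_poly leq_subLR add1n.
  rewrite (leq_trans (size_polyD _ _))// geq_max size_polyN.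
  by rewrite !size_mulC//; [exact: hbox.1|exact: bG.1].
have b2 (c' : R[i]) i : bm (fun x => c' * (mono i 0 x * evx F x / evx p x)).
  by apply: bmeasM; [exact: bmeas_cst|exact: bm_qcoef].
transitivity (\sum_(l < size s) cj s`_l * qcoef (F`_0) (- (k + l)%N%:Z)).
  under [RHS]eq_bigr do rewrite /qcoef -(mean_over_p_const hp) -(meanZ _ (bm_qcoef _ _ _)).
  rewrite -mean_sum//; apply: eq_mean => x.
  have P0 := evp_neq0 hp x; have P'0 : cj (evx p x) != 0 by rewrite conjc_eq0.
  have -> : evx ('X^k%:P * (s%:P * p)) x
      = (\sum_(l < size s) s`_l * mono (k + l)%N%:Z 0 x) * evx p x.
    rewrite !evxM evxZn mulrA; congr (_ * _).
    rewrite /evx evC horner_coef mulr_sumr; apply: eq_bigr => l _.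
    by rewrite !monoE !expr0z !mulr1 mulrCA PoszD expfzDr ?circ_neq0.
  rewrite cjM /weight invfM cj_sum.
  transitivity (evx F x * (\sum_(l < size s) cj (s`_l * mono (k + l)%N%:Z 0 x)) / evx p x).
    by field; rewrite P0.
  rewrite mulr_sumr mulr_suml; apply: eq_bigr => l _.
  by rewrite cjM mono_conj oppr0; ring.
by rewrite F0 big1// => l _; rewrite qcoef_ga ?mulr0//; lia.
Qed.

End SplitFactors.

(** * The linear form as a weighted pairing *)

Lemma laurent_monoM (K : fieldType) (x y c d : K) (s t s' t' : nat) : x != 0 -> y != 0 ->
  c * (x ^+ s * y ^+ t) * (d * (x^-1 ^+ s' * y^-1 ^+ t'))
  = c * d * (x ^ (s%:Z - s'%:Z) * y ^ (t%:Z - t'%:Z)).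
Proof.
move=> x0 y0; rewrite !expfzDr// -!exprnP -!exprnN !exprVn; ring.
Qed.

Section LinearForm.
Variables (R : realType) (n m : nat) (T : ratfun R -> R[i]).
Hypothesis hlin : linear_form n m T.
Implicit Types (f g : bipoly R) (F G : ratfun R).
Local Notation L := (@laurent R n m).

Lemma ratconst0 : ratconst (0 : R[i]) = 0 :> ratfun R.
Proof. by rewrite /ratconst !rmorph0. Qed.

Lemma ratconstM (c d : R[i]) : ratconst (c * d) = ratconst c * ratconst d :> ratfun R.
Proof. by rewrite /ratconst !rmorphM. Qed.

Lemma ratconstD (c d : R[i]) : ratconst (c + d) = ratconst c + ratconst d :> ratfun R.
Proof. by rewrite /ratconst !rmorphD. Qed.

Lemma ratconst1 : ratconst (1 : R[i]) = 1 :> ratfun R.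
Proof. by rewrite /ratconst !rmorph1. Qed.

Lemma laurent_lin (c : R[i]) F G : L F -> L G -> L (ratconst c * F + G).
Proof.
move=> [A ->] [B ->]; exists (c *: A + B).
rewrite mulr_sumr -big_split/=; apply: eq_bigr => s _.
rewrite mulr_sumr -big_split/=; apply: eq_bigr => t _.
by rewrite !mxE ratconstD ratconstM; ring.
Qed.

Lemma laurent0 : L 0.
Proof.
exists 0; rewrite big1// => s _; rewrite big1// => t _.
by rewrite mxE ratconst0 mul0r.
Qed.

Lemma laurent_mono (j k : int) : `|j| <= n%:Z -> `|k| <= m%:Z ->
  L (zvar R ^ j * wvar R ^ k).
Proof.
move=> hj hk.
have hs : (`|(j + n%:Z)%R| < (2 * n).+1)%N by lia.
have ht : (`|(k + m%:Z)%R| < (2 * m).+1)%N by lia.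
exists (delta_mx (Ordinal hs) (Ordinal ht)).
rewrite (bigD1 (Ordinal hs))//= [X in _ + X]big1 ?addr0; last first.
  by move=> s ss; rewrite big1// => t _; rewrite mxE (negbTE ss) ratconst0 mul0r.
rewrite (bigD1 (Ordinal ht))//= [X in _ + X]big1 ?addr0; last first.
  by move=> t tt; rewrite mxE (negbTE tt) andbF ratconst0 mul0r.
rewrite mxE !eqxx ratconst1 mul1r; congr (zvar R ^ _ * wvar R ^ _); lia.
Qed.

Lemma T0 : T 0 = 0.
Proof.
have e : ratconst (-1 : R[i]) * 0 + 0 = 0 :> ratfun R by rewrite mulr0 addr0.
by have := hlin (-1) laurent0 laurent0; rewrite e mulN1r addNr.
Qed.

Lemma laurent_sum (I : Type) (r : seq I) (F : I -> ratfun R) :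
  (forall i, L (F i)) -> L (\sum_(i <- r) F i).
Proof.
move=> h; elim/big_rec: _ => [|i G _ LG]; first exact: laurent0.
by rewrite -[F i]mul1r -ratconst1; exact: laurent_lin.
Qed.

Lemma T_sum (I : Type) (r : seq I) (F : I -> ratfun R) :
  (forall i, L (F i)) -> T (\sum_(i <- r) F i) = \sum_(i <- r) T (F i).
Proof.
move=> h; elim: r => [|i r IH]; first by rewrite !big_nil T0.
rewrite !big_cons -IH -[F i in LHS]mul1r -ratconst1 hlin ?mul1r//.
exact: laurent_sum.
Qed.

Lemma T_scale (c : R[i]) F : L F -> T (ratconst c * F) = c * T F.
Proof.
by move=> LF; have := hlin c LF laurent0; rewrite !addr0 T0 addr0.
Qed.

Lemma laurent_scale (c : R[i]) F : L F -> L (ratconst c * F).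
Proof. by move=> LF; have := laurent_lin c LF laurent0; rewrite addr0. Qed.

Lemma subst_box N M f (x y : ratfun R) : box N M f ->
  subst f x y = \sum_(t < M) \sum_(s < N) ratconst ((f`_t)`_s) * (x ^+ s * y ^+ t).
Proof.
move=> [h1 h2]; rewrite /subst /map_poly horner_poly.
have inner (r : {poly R[i]}) : (size r <= N)%N ->
    (\poly_(i < size r) ratconst r`_i).[x] = \sum_(s < N) ratconst r`_s * x ^+ s.
  move=> hr; rewrite horner_poly (big_ord_widen N (fun s => ratconst r`_s * x ^+ s))//.
  rewrite big_mkcond/=; apply: eq_bigr => s _; case: ltnP => // hs.
  by rewrite nth_default// ratconst0 mul0r.
transitivity (\sum_(t < size f) (\sum_(s < N) ratconst ((f`_t)`_s) * x ^+ s) * y ^+ t).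
  by apply: eq_bigr => t _; rewrite inner.
rewrite (big_ord_widen M (fun t => (\sum_(s < N) ratconst ((f`_t)`_s) * x ^+ s) * y ^+ t))//.
rewrite big_mkcond/=; apply: eq_bigr => t _; case: ltnP => ht.
  by rewrite mulr_suml; apply: eq_bigr => s _; rewrite mulrA.
by rewrite big1// => s _; rewrite (_ : f`_t = 0) ?coef0 ?ratconst0 ?mul0r// nth_default.
Qed.

Lemma coef_barp f s t : ((barp f)`_t)`_s = cj ((f`_t)`_s).
Proof.
rewrite /barp coef_map_id0; last by rewrite map_poly0.
by rewrite coef_map_id0// conjc0.
Qed.

Lemma box_barp N M f : box N M f -> box N M (barp f).
Proof.
move=> [h1 h2]; split=> [|t]; first exact: leq_trans (size_poly _ _) h1.
rewrite /barp coef_map_id0; last by rewrite map_poly0.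
exact: leq_trans (size_poly _ _) (h2 t).
Qed.

Lemma zvar_neq0 : zvar R != 0.
Proof. by rewrite tofrac_eq0 polyC_eq0 polyX_eq0. Qed.
Lemma wvar_neq0 : wvar R != 0.
Proof. by rewrite tofrac_eq0 polyX_eq0. Qed.

Lemma ip_expand f g : box n.+1 m.+1 f -> box n.+1 m.+1 g ->
  ip T f g = \sum_(t < m.+1) \sum_(s < n.+1) \sum_(t' < m.+1) \sum_(s' < n.+1)
    (f`_t)`_s * cj ((g`_t')`_s') *
    T (zvar R ^ (s%:Z - s'%:Z) * wvar R ^ (t%:Z - t'%:Z)).
Proof.
move=> bf bg; rewrite /ip (subst_box _ _ bf) (subst_box _ _ (box_barp bg)).
have Lm (s s' : 'I_n.+1) (t t' : 'I_m.+1) :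
    L (zvar R ^ (s%:Z - s'%:Z) * wvar R ^ (t%:Z - t'%:Z)).
  by apply: laurent_mono; have := ltn_ord s; have := ltn_ord s'; have := ltn_ord t;
    have := ltn_ord t'; lia.
pose X (t : 'I_m.+1) (s : 'I_n.+1) (t' : 'I_m.+1) (s' : 'I_n.+1) : ratfun R :=
  ratconst ((f`_t)`_s * cj ((g`_t')`_s')) *
    (zvar R ^ (s%:Z - s'%:Z) * wvar R ^ (t%:Z - t'%:Z)).
have LX t s t' s' : L (X t s t' s') by apply: laurent_scale; exact: Lm.
transitivity (T (\sum_t \sum_s \sum_t' \sum_s' X t s t' s')).
  congr (T _); rewrite mulr_suml; apply: eq_bigr => t _.
  rewrite mulr_suml; apply: eq_bigr => s _.
  rewrite mulr_sumr; apply: eq_bigr => t' _.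
  rewrite mulr_sumr; apply: eq_bigr => s' _.
  rewrite /X coef_barp ratconstM.
  by apply: laurent_monoM; [exact: zvar_neq0|exact: wvar_neq0].
rewrite T_sum; last by move=> t; do 3! (apply: laurent_sum => ?).
apply: eq_bigr => t _; rewrite T_sum; last by move=> s; do 2! (apply: laurent_sum => ?).
apply: eq_bigr => s _; rewrite T_sum; last by move=> t'; apply: laurent_sum => ?.
apply: eq_bigr => t' _; rewrite T_sum//.
by apply: eq_bigr => s' _; rewrite T_scale.
Qed.

Variable p : bipoly R.
Hypothesis hp : forall z w : R[i], `|z| = 1 -> `|w| <= 1 -> ev p z w != 0.
Hypothesis hT : forall j k : int, `|j| <= n%:Z -> `|k| <= m%:Z ->
    T (zvar R ^ j * wvar R ^ k) =
    torus_int (fun z w => z ^ j * w ^ k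
                 / (((2 * pi) ^+ 2)%:C * `|ev p z w| ^+ 2)).

Lemma T_moment j k : `|j| <= n%:Z -> `|k| <= m%:Z ->
  T (zvar R ^ j * wvar R ^ k) = mean (fun x => mono j k x * weight p x).
Proof.
move=> hj hk; rewrite hT// /mean.
rewrite -(cintZ (@square_meas R) (@leb2_square_fin R)); last first.
  by apply: bmeasM; [exact: bm_mono|exact: bm_weight hp].
apply: eq_cint => x _; rewrite monoE /weight -/(evx p x) sqr_normc.
by rewrite invfM -fmorphV; ring.
Qed.

Lemma ip_ipw f g : box n.+1 m.+1 f -> box n.+1 m.+1 g -> ip T f g = ipw p f g.
Proof.
move=> bf bg; rewrite ip_expand//.
have b1 i j : bmeas (@square R) (fun x => mono i j x * weight p x).
  by apply: bmeasM; [exact: bm_mono|exact: bm_weight hp].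
have b2 (c : R[i]) i j : bmeas (@square R) (fun x => c * (mono i j x * weight p x)).
  by apply: bmeasM => //; exact: bmeas_cst.
pose X (t : 'I_m.+1) (s : 'I_n.+1) (t' : 'I_m.+1) (s' : 'I_n.+1) x : R[i] :=
  (f`_t)`_s * cj ((g`_t')`_s') * (mono (s%:Z - s'%:Z) (t%:Z - t'%:Z) x * weight p x).
transitivity (mean (fun x => \sum_t \sum_s \sum_t' \sum_s' X t s t' s' x)).
  rewrite mean_sum; last by move=> t _; do 3! (apply: bmeas_sum => ? _); exact: b2.
  apply: eq_bigr => t _.
  rewrite mean_sum; last by move=> s _; do 2! (apply: bmeas_sum => ? _); exact: b2.
  apply: eq_bigr => s _.
  rewrite mean_sum; last by move=> t' _; (apply: bmeas_sum => ? _); exact: b2.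
  apply: eq_bigr => t' _; rewrite mean_sum; last by move=> s' _; exact: b2.
  apply: eq_bigr => s' _; rewrite /X meanZ// T_moment//.
    by have := ltn_ord s; have := ltn_ord s'; lia.
  by have := ltn_ord t; have := ltn_ord t'; lia.
apply: eq_mean => x; rewrite (evx_box _ bf) (evx_box _ bg) !mulr_suml.
apply: eq_bigr => t _; rewrite !mulr_suml; apply: eq_bigr => s _.
rewrite cj_sum mulr_sumr mulr_suml; apply: eq_bigr => t' _.
rewrite cj_sum mulr_sumr mulr_suml; apply: eq_bigr => s' _.
by rewrite /X cjM mono_conj -monoM; ring.
Qed.

End LinearForm.

(** * Orthogonal projections *)

Section Projection.
Variables (R : realType) (p : bipoly R).
Hypothesis hp : forall z w : R[i], `|z| = 1 -> `|w| <= 1 -> ev p z w != 0.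
Implicit Types (f g h u : bipoly R) (es : seq (bipoly R)).

(** The span as an intersection, which makes membership in, and orthogonality to,
    any subspace immediate. *)
Definition spanned es u := forall W : set (bipoly R),
  is_subspace W -> (forall e, e \in es -> W e) -> W u.

Lemma subspace_orth g : is_subspace [set h | ipw p g h = 0].
Proof.
split=> [|c f h /= hf hh] /=; first exact: ipw0r.
by rewrite ipwDr// ipwZr// hf hh mulr0 addr0.
Qed.

(** The Gram-Schmidt process; definiteness on the span excludes the isotropic
    vectors for which it would fail. *)
Lemma orth_projection es f :
    (forall u, spanned es u -> ipw p u u = 0 -> u = 0) ->
  exists u, spanned es u /\ forall e, e \in es -> ipw p (f - u) e = 0.
Proof.
elim: es f => [|e es IH] f hpos.
  by exists 0; split=> // W [].
have sub u : spanned es u -> spanned (e :: es) u.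
  by move=> su W hW h; apply: su => // e' e'es; apply: h; rewrite in_cons e'es orbT.
have hpos' u : spanned es u -> ipw p u u = 0 -> u = 0 by move=> /sub; exact: hpos.
have lin c u v : spanned (e :: es) u -> spanned (e :: es) v ->
    spanned (e :: es) (c%:P%:P * u + v).
  by move=> su sv W hW h; apply: hW.2; [exact: su|exact: sv].
have se : spanned (e :: es) e by move=> W _; apply; rewrite mem_head.
have [u0 [su0 ou0]] := IH e hpos'.
have [u1 [su1 ou1]] := IH f hpos'.
pose r := e - u0; pose g := f - u1.
have sr : spanned (e :: es) r.
  have := lin (-1) _ _ (sub _ su0) se.
  by rewrite !rmorphN !rmorph1 mulN1r addrC.
have orth_u0 h : (forall e, e \in es -> ipw p h e = 0) -> ipw p h u0 = 0.
  by move=> hh; apply: (su0 [set v | ipw p h v = 0]) => //; exact: subspace_orth.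
have er : e = r + u0 by rewrite /r subrK.
have [rr0|rr0] := eqVneq (ipw p r r) 0.
  exists u1; split; first exact: sub.
  move=> e'; rewrite in_cons => /predU1P[->|]; last exact: ou1.
  by rewrite er (hpos _ sr rr0) add0r orth_u0.
pose c := ipw p g r / ipw p r r.
exists (c%:P%:P * r + u1); split; first by apply: lin => //; exact: sub.
have -> : f - (c%:P%:P * r + u1) = (- c)%:P%:P * r + g.
  by rewrite /g !rmorphN mulNr; ring.
have orth e' : e' \in es -> ipw p ((- c)%:P%:P * r + g) e' = 0.
  by move=> h; rewrite ipwDl// ipwZl// ou0// ou1// mulr0 addr0.
move=> e'; rewrite in_cons => /predU1P[->|]; last exact: orth.
rewrite er ipwDr// (orth_u0 _ orth) addr0 ipwDl// ipwZl// /c.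
by rewrite mulNr divfK// addNr.
Qed.

End Projection.

Section SplitShift.
Variables (R : realType) (n m : nat) (T : ratfun R -> R[i]).
Hypothesis hlin : linear_form n m T.
Hypothesis hpos : positive_form n m T.
Variable p : bipoly R.
Hypothesis hbox : box n.+1 m.+1 p.
Hypothesis hp : forall z w : R[i], `|z| = 1 -> `|w| <= 1 -> ev p z w != 0.
Hypothesis hT : forall j k : int, `|j| <= n%:Z -> `|k| <= m%:Z ->
    T (zvar R ^ j * wvar R ^ k) =
    torus_int (fun z w => z ^ j * w ^ k
                 / (((2 * pi) ^+ 2)%:C * `|ev p z w| ^+ 2)).
Implicit Types (f g h : bipoly R).
Local Notation E := (E1 T (n%:Z - 1) m%:Z).

Lemma box_le N N' M M' f : (N <= N')%N -> (M <= M')%N -> box N M f -> box N' M' f.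
Proof.
by move=> hN hM [h1 h2]; split=> [|t]; [exact: leq_trans hM|exact: leq_trans hN].
Qed.

Lemma box_subspace N M : is_subspace (box N M : set (bipoly R)).
Proof.
split=> [|c f g [f1 f2] [g1 g2]].
  by split=> [|t]; rewrite ?coef0 ?size_poly0.
split=> [|t].
  by rewrite (leq_trans (size_polyD _ _))// geq_max size_mulC.
rewrite coefD coefCM (leq_trans (size_polyD _ _))// geq_max g2 andbT.
by rewrite mul_polyC (leq_trans (size_scale_leq _ _)).
Qed.

Lemma boxB N M f g : box N M f -> box N M g -> box N M (f - g).
Proof.
move=> bf bg; have := (box_subspace N M).2 (-1) g f bg bf.
by rewrite !rmorphN !rmorph1 mulN1r addrC.
Qed.

Lemma box_wmul N M f : box N M f -> box N M.+1 ('X * f).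
Proof.
move=> [h1 h2]; split=> [|t]; last first.
  by rewrite mulrC coefMX; case: ifP; rewrite ?size_poly0.
by rewrite (leq_trans (size_polyMleq _ _))// size_polyX add2n.
Qed.

Lemma box_zmul N M f : box N M f -> box N.+1 M ('X%:P * f).
Proof.
move=> [h1 h2]; split=> [|t]; first exact: size_mulC.
by rewrite coefCM (leq_trans (size_polyMleq _ _))// size_polyX add2n ltnS h2.
Qed.

Lemma box_wide f : box n m.+1 f -> box n.+1 m.+1 f.
Proof. by apply: box_le. Qed.

Lemma E1P N f : (N <= n.+1)%N -> E1 T (N%:Z - 1) m%:Z f <->
  box N m.+1 f /\ forall h, box N m h -> ipw p f ('X * h) = 0.
Proof.
move=> Nn; have em : m%:Z = m.+1%:Z - 1 by lia.
have wide g : box N m.+1 g -> box n.+1 m.+1 g by apply: box_le.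
rewrite /E1 /ominus /wmul /=; split=> [[h1 h2]|[h1 h2]].
  have bf : box N m.+1 f by apply/PspaceP; rewrite -em.
  split=> // h bh; rewrite -(ip_ipw hlin hp hT)//; [|exact: wide|exact/wide/box_wmul].
  by apply: h2; exists h => //; apply/PspaceP.
split; first by rewrite em; exact/PspaceP.
move=> _ [h /PspaceP bh <-]; rewrite (ip_ipw hlin hp hT) ?h2//.
  exact: wide.
exact/wide/box_wmul.
Qed.

Lemma EP f : E f <-> box n m.+1 f /\ forall h, box n m h -> ipw p f ('X * h) = 0.
Proof. exact: E1P. Qed.

Lemma E_subspace : is_subspace E.
Proof.
split=> [|c f g /EP[bf hf] /EP[bg hg]]; apply/EP; split.
- exact: (box_subspace n m.+1).1.
- by move=> h _; exact: ipw0l.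
- exact: (box_subspace n m.+1).2.
- by move=> h bh; rewrite ipwDl// ipwZl// hf// hg// mulr0 addr0.
Qed.

Lemma ipw_definite f : box n.+1 m.+1 f -> ipw p f f = 0 -> f = 0.
Proof.
move=> bf ff; apply/eqP; apply/negP => /negP f0.
have bf' : Pspace n%:Z m%:Z f.
  have -> : n%:Z = n.+1%:Z - 1 by lia.
  have -> : m%:Z = m.+1%:Z - 1 by lia.
  exact/PspaceP.
by have := hpos bf' f0; rewrite (ip_ipw hlin hp hT)// ff ltxx.
Qed.

Lemma E_orth_wmul_eq0 f h : E f -> box n m h -> f = 'X * h -> f = 0.
Proof.
move=> /EP[bf hf] bh e; apply: ipw_definite; first exact: box_wide.
by rewrite {2}e hf.
Qed.

Lemma box_monomial s t : (s < n)%N -> (t < m)%N -> box n m ('X^s%:P * 'X^t : bipoly R).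
Proof.
move=> sn tm; split=> [|t']; first by rewrite size_mulC// size_polyXn.
rewrite coefCM coefXn; case: eqP => _; last by rewrite mulr0 size_poly0.
by rewrite mulr1 size_polyXn.
Qed.

Lemma moment_ipw f i j : moment p f i%:Z j.+1 = ipw p f ('X * ('X^i%:P * 'X^j)).
Proof.
rewrite /moment /ipw; apply: eq_mean => x; rewrite !evxM evxZn -['X]expr1 !evxXn !monoM.
by rewrite !add0r addr0 -PoszD add1n.
Qed.

(** The orthogonal projection onto [w P_(n - 1, m - 1)], spanned by monomials. *)
Lemma decomposition f : box n m.+1 f -> exists e h, [/\ E e, box n m h & f = e + 'X * h].
Proof.
move=> bf.
pose es := [seq 'X * ('X^s%:P * 'X^t) : bipoly R | s <- iota 0 n, t <- iota 0 m].
have sp u : spanned es u -> exists2 h, box n m h & u = 'X * h.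
  move=> su; apply: (su [set u | exists2 h, box n m h & u = 'X * h]) => [|e].
    split=> [|c _ _ [h1 b1 ->] [h2 b2 ->]].
      by exists 0; rewrite ?mulr0//; exact: (box_subspace n m).1.
    exists (c%:P%:P * h1 + h2); first exact: (box_subspace n m).2.
    by rewrite mulrDr mulrCA.
  move=> /allpairsP[[s t] /= [hs ht ->]]; exists ('X^s%:P * 'X^t) => //.
  by rewrite !mem_iota !add0n in hs ht *; exact: box_monomial.
have [|u [su ou]] := @orth_projection R p hp es f.
  move=> u /sp[h bh ->]; apply: ipw_definite; exact/box_wide/box_wmul.
have [h bh eu] := sp _ su.
exists (f - u), h; split=> //; last by rewrite eu subrK.
apply/EP; split; first by apply: boxB => //; rewrite eu; exact: box_wmul.
move=> h' bh'; apply: (ipw_wmul_eq0 hp bh') => i j hi hj.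
rewrite moment_ipw; apply: ou.
by apply/allpairsP; exists (i, j); rewrite /= !mem_iota !add0n.
Qed.

Lemma is_projP f h : box n m.+1 f -> is_proj T E f h <->
  E h /\ exists2 g, box n m g & f - h = 'X * g.
Proof.
move=> bf; rewrite /is_proj; split=> [[Eh oh]|[Eh [g bg eg]]]; split=> //.
  have [bh _] := (EP h).1 Eh.
  have [e [g [Ee bg eg]]] := decomposition (boxB bf bh).
  exists g => //; have [be he] := (EP e).1 Ee.
  suff e0 : e = 0 by rewrite eg e0 add0r.
  apply: ipw_definite; first exact: box_wide.
  have := oh _ Ee; rewrite (ip_ipw hlin hp hT); [|exact/box_wide/boxB|exact: box_wide].
  by rewrite eg ipwDl// [ipw p ('X * g) e]ipwC// he// conjc0 addr0.
move=> k Ek; have [bk hk] := (EP k).1 Ek.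
rewrite eg (ip_ipw hlin hp hT); [|exact/box_wide/box_wmul|exact: box_wide].
by rewrite ipwC// hk// conjc0.
Qed.

Lemma moment_E f : E f -> forall i j, (i < n)%N -> (j < m)%N -> moment p f i%:Z j.+1 = 0.
Proof.
by move=> /EP[bf hf] i j hi hj; rewrite moment_ipw hf//; exact: box_monomial.
Qed.

(** The projection onto [E] changes only the coefficients of positive powers of
    [w], hence is determined by the constant coefficient. *)
Lemma proj_multiplesP (q : {poly R[i]}) (d : nat) h :
    (forall r : {poly R[i]}, (size r <= d)%N -> (size (r * q)%R <= n)%N) ->
  proj_image T E (multiples q d%:Z) h <->
  E h /\ exists2 r : {poly R[i]}, (size r <= d)%N & h`_0 = r * q.
Proof.
move=> hq.
have bC (r : {poly R[i]}) : (size r <= d)%N -> box n m.+1 (r * q)%:P.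
  move=> sr; split=> [|t]; first by rewrite (leq_trans (size_polyC_leq1 _)).
  by rewrite coefC; case: eqP => _; rewrite ?size_poly0 ?hq.
split=> [[_ [r /degp_lt sr <-]]|[Eh [r sr h0]]].
  move=> /(is_projP _ (bC _ sr))[Eh [g bg eg]]; split=> //; exists r => //.
  apply/eqP; rewrite eq_sym -subr_eq0; apply/eqP.
  have : ((r * q)%:P - h)`_0 = ('X * g)`_0 by rewrite eg.
  by rewrite coefB coefC coefXM.
exists (r * q)%:P; first by exists r => //; exact/degp_lt.
apply/(is_projP _ (bC _ sr)); split=> //.
have bh := ((EP h).1 Eh).1.
have bd := boxB (bC _ sr) bh; exists (drop_poly 1 ((r * q)%:P - h)).
  split=> [|t]; last by rewrite coef_drop_poly bd.2.
  by rewrite size_drop_poly leq_subLR add1n bd.1.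
by apply: divX_of_coef0; rewrite coefB coefC h0 subrr.
Qed.

Lemma proj_multiples_subspace (q : {poly R[i]}) (d : nat) :
    (forall r : {poly R[i]}, (size r <= d)%N -> (size (r * q)%R <= n)%N) ->
  is_subspace (proj_image T E (multiples q d%:Z)).
Proof.
move=> hq; have KP h := proj_multiplesP h hq.
split=> [|c f g /KP[Ef [r sr fr]] /KP[Eg [s ss gs]]]; apply/KP; split.
- exact: E_subspace.1.
- by exists 0; rewrite ?size_poly0// coef0 mul0r.
- exact: E_subspace.2.
- exists (c%:P * r + s); last by rewrite coefD coefCM fr gs; ring.
  rewrite (leq_trans (size_polyD _ _))// geq_max ss andbT mul_polyC.
  exact: leq_trans (size_scale_leq _ _) sr.
Qed.

(** Take for [r] the remainder modulo [b] of [e] times the Bezout coefficient of [a];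
    the degree of [s] is then forced. *)
Lemma coprime_decomposition (a b e : {poly R[i]}) :
    coprimep a b -> b != 0 -> (size a + size b <= n.+2)%N -> (size e <= n)%N ->
  exists r s : {poly R[i]},
  [/\ (size r <= (size b).-1)%N, (size s <= n - (size b).-1)%N & e = r * a + s * b].
Proof.
move=> /Bezout_eq1_coprimepP[[u v] /= uv] b0 sab se.
pose r := (e * u) %% b; pose s := ((e * u) %/ b) * a + e * v.
have er : e = r * a + s * b.
  rewrite -[LHS]mulr1 -uv mulrDr mulrA {1}(divp_eq (e * u) b) /r /s; ring.
have b_gt0 : (0 < size b)%N by rewrite size_poly_gt0.
have sr : (size r <= (size b).-1)%N by rewrite -ltnS prednK// ltn_modp.
exists r, s; split=> //.
have [->|s0] := eqVneq s 0; first by rewrite size_poly0.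
have sra : (size (r * a)%R <= n)%N.
  apply: leq_trans (size_polyMleq _ _) _; move: sr sab b_gt0.
  by move: (size r) (size a) (size b) => x y z; lia.
have : (size (s * b)%R <= n)%N.
  have -> : s * b = e - r * a by rewrite er addrC addKr.
  by rewrite (leq_trans (size_polyD _ _))// geq_max size_polyN se.
rewrite size_mul//; move: s0 b_gt0; rewrite -size_poly_gt0.
by move: (size s) (size b) => x y; lia.
Qed.

End SplitShift.

(** * The split-shift condition *)

Theorem theorem2p3 (R : realType) (n m : nat) (T : ratfun R -> R[i])
  (hlin : linear_form n m T) (hpos : positive_form n m T)
  (p : bipoly R) (hdeg : Pspace n%:Z m%:Z p)
  (hp : forall z w : R[i], `|z| = 1 -> `|w| <= 1 -> ev p z w != 0)
  (hT : forall j k : int, `|j| <= n%:Z -> `|k| <= m%:Z ->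
    T (zvar R ^ j * wvar R ^ k) =
    torus_int (fun z w => z ^ j * w ^ k
                 / (((2 * pi) ^+ 2)%:C * `|ev p z w| ^+ 2)))
  (a b : {poly R[i]}) (hab : p`_0 = a * b)
  (ha : forall z : R[i], `|z| <= 1 -> a.[z] != 0)
  (hb : forall z : R[i], b.[z] = 0 -> `|z| < 1) :
  split_shift T n m
    (proj_image T (E1 T (n%:Z - 1) m%:Z) (multiples a (degp b)%:Z))
    (proj_image T (E1 T (n%:Z - 1) m%:Z) (multiples b (n%:Z - (degp b)%:Z))).
Proof.
have hbox : box n.+1 m.+1 p.
  apply/PspaceP; have -> : n.+1%:Z - 1 = n%:Z by lia.
  by have -> : m.+1%:Z - 1 = m%:Z by lia.
have b0 := b_neq0 hb; have sab := size_ab hbox hab ha hb.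
have [sa sb] : (0 < size a)%N /\ (0 < size b)%N by rewrite !size_poly_gt0 (a_neq0 ha).
pose d := (size b).-1; rewrite -[degp b]/d.
have dn : (d <= n)%N.
  by rewrite /d; move: sab sa sb; move: (size a) (size b) => x y; lia.
have -> : n%:Z - d%:Z = (n - d)%N%:Z by lia.
set E := E1 T (n%:Z - 1) m%:Z.
set K1 := proj_image T E _; set K2 := proj_image T E _.
have sra (r : {poly R[i]}) : (size r <= d)%N -> (size (r * a)%R <= n)%N.
  move=> sr; apply: leq_trans (size_polyMleq _ _) _; move: sr sab sa sb; rewrite /d.
  by move: (size r) (size a) (size b) => x y z; lia.
have srb (r : {poly R[i]}) : (size r <= n - d)%N -> (size (r * b)%R <= n)%N.
  move=> sr; apply: leq_trans (size_polyMleq _ _) _; move: sr dn sb; rewrite /d.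
  by move: (size r) (size b) => x y; lia.
have K1P h : K1 h <-> _ := proj_multiplesP hlin hpos hp hT h sra.
have K2P h : K2 h <-> _ := proj_multiplesP hlin hpos hp hT h srb.
have EP' f : E f <-> _ := EP hlin hp hT f.
have Esub : is_subspace E := E_subspace hlin hp hT.
have mE := moment_E hlin hp hT.
have right f : K1 f -> forall i j : nat, (j < m)%N -> moment p f i%:Z j.+1 = 0.
  move=> /K1P[Ef [r sr f0]]; have [bf _] := (EP' f).1 Ef.
  exact: (split_right hbox hp hab hb bf f0 sr (mE _ Ef)).
have left f : K2 f -> forall (i : int) (j : nat), i < n%:Z -> (j < m)%N ->
    moment p f i j.+1 = 0.
  move=> /K2P[Ef [r sr f0]]; have [bf _] := (EP' f).1 Ef.
  exact: (split_left hbox hp hab ha bf f0 (mE _ Ef)).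
have orth f g : K1 f -> K2 g -> forall k, ipw p f ('X^k%:P * g) = 0.
  move=> K1f /K2P[Eg [s ss g0]]; have hf := right _ K1f.
  have /K1P[Ef [r sr f0]] := K1f.
  have [bf _] := (EP' f).1 Ef; have [bg _] := (EP' g).1 Eg.
  exact: (split_orth hbox hp hab ha hb bf bg f0 sr g0 hf).
have bE f : E f -> box n m.+1 f by move=> /EP'[].
have K1E f : K1 f -> E f by move=> /K1P[].
have K2E f : K2 f -> E f by move=> /K2P[].
have wide f : box n m.+1 f -> box n.+1 m.+1 f by exact: box_wide.
split.
- by split; exact: (proj_multiples_subspace hlin hpos hp hT).
- split; last first.
    move=> f g K1f K2g; rewrite (ip_ipw hlin hp hT); [|exact/wide/bE/K1E|exact/wide/bE/K2E].
    by rewrite -[g]mul1r -(rmorph1 polyC) -(expr0 'X) orth.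
  apply/seteqP; split=> [e Ee|_ [f K1f [g K2g <-]]]; last first.
    by rewrite -[f]mul1r -!(rmorph1 polyC); apply: Esub.2; [exact: K1E|exact: K2E].
  have se : (size (e`_0)%R <= n)%N by exact: (bE _ Ee).2.
  have cab : coprimep a b.
    apply: Pdiv.ClosedField.root_coprimep => x /rootP ax0; apply/eqP => /hb/ltW/ha.
    by rewrite ax0 eqxx.
  have [r [s [sr ss e0]]] := coprime_decomposition cab b0 sab se.
  have lift (c : {poly R[i]}) : (size c <= n)%N -> exists2 f, E f & f`_0 = c.
    move=> sc; have bc : box n m.+1 c%:P.
      split=> [|t]; first by rewrite (leq_trans (size_polyC_leq1 _)).
      by rewrite coefC; case: eqP => _; rewrite ?size_poly0.
    have [f [h [Ef bh ec]]] := decomposition hlin hpos hp hT bc.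
    exists f => //; have : (c%:P)`_0 = (f + 'X * h)`_0 by rewrite -ec.
    by rewrite coefC coefD coefXM addr0.
  have [f Ef f0] := lift _ (sra _ sr); have [g Eg g0] := lift _ (srb _ ss).
  have subE u v : E u -> E v -> E (u - v).
    move=> Eu Ev; have := Esub.2 (-1) v u Ev Eu.
    by rewrite !rmorphN !rmorph1 mulN1r addrC.
  (* An element of [E] divisible by [w] is orthogonal to itself. *)
  have Er := subE _ _ (subE _ _ Ee Ef) Eg.
  have er0 : e - f - g = 'X * drop_poly 1 (e - f - g).
    by apply: divX_of_coef0; rewrite !coefB e0 f0 g0; ring.
  have z : e - f - g = 0.
    apply: (E_orth_wmul_eq0 hlin hpos hp hT Er _ er0); have br := bE _ Er.
    split=> [|t]; last by rewrite coef_drop_poly br.2.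
    by rewrite size_drop_poly leq_subLR add1n br.1.
  exists f; first by apply/K1P; split=> //; exists r.
  exists g; first by apply/K2P; split=> //; exists s.
  by apply/eqP; rewrite eq_sym -subr_eq0 opprD addrA z.
- move=> f _ K1f [g K2g <-]; rewrite (ip_ipw hlin hp hT).
  + by rewrite -(orth f g K1f K2g 1%N).
  + exact/wide/bE/K1E.
  + exact/box_zmul/bE/K2E.
- split=> [f K1f|_ [g K2g <-]].
    have -> : n%:Z = n.+1%:Z - 1 by lia.
    apply/(E1P hlin hp hT) => //; split=> [|h bh]; first exact/wide/bE/K1E.
    by apply: (ipw_wmul_eq0 hp bh) => i j _; exact: right.
  have -> : n%:Z = n.+1%:Z - 1 by lia.
  apply/(E1P hlin hp hT) => //; split=> [|h bh]; first exact/box_zmul/bE/K2E.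
  apply: (ipw_wmul_eq0 hp bh) => i j hi jm.
  (* Multiplication by [z] shifts the moments by one. *)
  rewrite -(left g K2g (i%:Z - 1) j _ jm); last by lia.
  rewrite /moment; apply: eq_mean => x; rewrite evxM -['X]expr1 evxZn.
  have -> : mono i j.+1 x = mono (i%:Z - 1) j.+1 x * mono 1 0 x.
    by rewrite monoM addr0 subrK.
  rewrite cjM; have : mono 1 0 x * cj (mono 1 0 x) = 1 by exact: mono_mulJ.
  move: (mono 1 0 x) => u hu; transitivity
    (u * cj u * (evx g x * cj (mono (i%:Z - 1) j.+1 x) * weight p x)); first by ring.
  by rewrite hu mul1r.
Qed.
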